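(* Consider LPC-SVRG (defined in the context) and assume $P$ attains its minimum at $x^*$. Let $T=Sm$, $\eta=\rho/L$ with $0<\rho<\tfrac12$, and let $d_\lambda\ge0$ be a number such that almost surely, at every iteration and for every worker $i$, the number of coordinates of $u_t^i$ lying outside $[-2^{b-1}\delta,(2^{b-1}-1)\delta]$ (with $\delta$ the scale factor used to quantize $u_t^i$) is at most $d_\lambda$. If communication scheme (a) or (b) is used and $$8m^2\rho^2\Big[\frac{d\lambda^2}{4(2^{b-1}-1)^2}+d_\lambda(1-\lambda)^2+\frac{1}{NB}\Big]+\rho\le 1,$$ or if communication scheme (c) is used and $$8m^2\rho^2\Big[\frac{3d\lambda^2}{8(2^{b-1}-1)^2}+d_\lambda(1-\lambda)^2+\frac{1}{NB}\Big]+\rho\le 1,$$ then the output satisfies $$\mathbf{E}\|G_\eta(x_{out})\|^2\le\frac{2L\,(P(x^0)-P(x^* ))}{\rho(1-2\rho)T}.$$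
   Context: Problem setting: $f_1,\dots,f_n:\mathbb{R}^d\to\mathbb{R}$ are differentiable (not necessarily convex) with $\|\nabla f_i(x)-\nabla f_i(y)\|\le L\|x-y\|$; $f=\frac1n\sum_i f_i$; $h:\mathbb{R}^d\to\mathbb{R}\cup\{+\infty\}$ is proper, convex and lower semicontinuous; $P=f+h$; $\mathrm{prox}_{\eta h}(x)=\arg\min_y\{h(y)+\frac{1}{2\eta}\|y-x\|^2\}$. The gradient mapping is $G_\eta(x)=\frac1\eta[x-\mathrm{prox}_{\eta h}(x-\eta\nabla f(x))]$. Quantization: for an integer $b\ge2$ and $\delta>0$, $\mathrm{dom}(\delta,b)=\{k\delta:k\in\mathbb{Z},-2^{b-1}\le k\le 2^{b-1}-1\}$; the scalar quantizer $Q_{(\delta,b)}(x)$, for $x\in[-2^{b-1}\delta,(2^{b-1}-1)\delta]$ with $z$ the largest grid point $\le x$, equals $z$ with probability $\frac{z+\delta-x}{\delta}$ and $z+\delta$ otherwise; for $x$ outside this interval it equals the nearest grid point. On vectors it acts coordinatewise with independent randomness. If $\delta=0$ (only when the vector to be quantized is $0$) the output is $0$. LPC-SVRG with $N$ workers, parameters $S,m,B\in\mathbb{N}$, $\eta>0$, $\lambda\in(0,1]$, $b\ge 2$, starting point $\tilde x^0=x^0$: for $s=0,\dots,S-1$, set $x_0^{s+1}=\tilde x^s$ and compute $\nabla f(\tilde x^s)$ exactly; for $t=0,\dots,m-1$: each worker $i$ draws $B$ indices independently and uniformly from $\{1,\dots,n\}$ (with replacement; independent across workers and iterations), forming $I_t^i$,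 and computes $u_t^i=\frac1B\sum_{a\in I_t^i}[\nabla f_a(x_t^{s+1})-\nabla f_a(\tilde x^s)]$; let $\delta_t^i=\frac{\lambda\|u_t^i\|_\infty}{2^{b-1}-1}$. Then $\tilde u_t$ is formed by one of: (a) $\tilde u_t=\frac1N\sum_i Q_{(\delta_t^i,b)}(u_t^i)$; (b) with $\delta_t=\max_i\delta_t^i$, $\tilde u_t=\frac1N\sum_i Q_{(\delta_t,b)}(u_t^i)$; (c) with $\delta_t=\max_i\delta_t^i$ and $\tilde u_t^i=Q_{(\delta_t,b)}(u_t^i)$, $\tilde u_t=Q_{(\delta_t,b)}(\frac1N\sum_i\tilde u_t^i)$ (fresh independent rounding). All roundings are independent given the sampled indices. Then $v_t^{s+1}=\tilde u_t+\nabla f(\tilde x^s)$, $x_{t+1}^{s+1}=\mathrm{prox}_{\eta h}(x_t^{s+1}-\eta v_t^{s+1})$; after the inner loop $\tilde x^{s+1}=x_m^{s+1}$. The output $x_{out}$ is chosen uniformly at random from $\{x_t^{s+1}:0\le t\le m-1,\ 0\le s\le S-1\}$. *)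

(* Defs.v *)
From Stdlib Require Import Reals ClassicalEpsilon.
From mathcomp Require Import all_boot.
Set Implicit Arguments. Unset Strict Implicit. Unset Printing Implicit Defensive.
Local Open Scope R_scope.

Definition vec (d : nat) := 'I_d -> R.
Definition vzero d : vec d := fun _ => 0.
Definition vadd d (x y : vec d) : vec d := fun k => x k + y k.
Definition vsub d (x y : vec d) : vec d := fun k => x k - y k.
Definition vscale d (a : R) (x : vec d) : vec d := fun k => a * x k.

Definition rsum (T : finType) (F : T -> R) : R := \big[Rplus/R0]_(t : T) F t.
Definition rprod (T : finType) (F : T -> R) : R := \big[Rmult/R1]_(t : T) F t.

Definition dot d (x y : vec d) : R := rsum (fun k : 'I_d => x k * y k).
Definition nrm2 d (x : vec d) : R := dot x x.
Definition nrm d (x : vec d) : R := sqrt (nrm2 x).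
Definition ninf d (x : vec d) : R := \big[Rmax/R0]_(k : 'I_d) Rabs (x k).

Definition has_gradient d (f : vec d -> R) (g : vec d -> vec d) : Prop :=
  forall x eps, 0 < eps -> exists del, 0 < del /\
    forall y, nrm (vsub y x) < del ->
      Rabs (f y - f x - dot (g x) (vsub y x)) <= eps * nrm (vsub y x).

Inductive ereal := EFin (r : R) | EPInf.
Definition ele (a b : ereal) : Prop :=
  match a, b with
  | EFin x, EFin y => x <= y
  | _, EPInf => True
  | EPInf, EFin _ => False
  end.
Definition elt (a b : ereal) : Prop :=
  match a, b with
  | EFin x, EFin y => x < y
  | EFin _, EPInf => True
  | EPInf, _ => False
  end.
Definition eaddr (a : ereal) (r : R) : ereal :=
  match a with EFin x => EFin (x + r) | EPInf => EPInf end.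

Definition proper_fun d (h : vec d -> ereal) : Prop := exists x r, h x = EFin r.
Definition convex_fun d (h : vec d -> ereal) : Prop :=
  forall x y a c th, h x = EFin a -> h y = EFin c -> 0 <= th <= 1 ->
    ele (h (vadd (vscale th x) (vscale (1 - th) y))) (EFin (th * a + (1 - th) * c)).
Definition lsc_fun d (h : vec d -> ereal) : Prop :=
  forall x c, elt (EFin c) (h x) -> exists eps, 0 < eps /\
    forall y, nrm (vsub y x) < eps -> elt (EFin c) (h y).

Definition is_prox d (h : vec d -> ereal) (eta : R) (x p : vec d) : Prop :=
  forall y, ele (eaddr (h p) (nrm2 (vsub p x) / (2 * eta)))
                (eaddr (h y) (nrm2 (vsub y x) / (2 * eta))).
Definition prox d (h : vec d -> ereal) (eta : R) (x : vec d) : vec d :=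
  epsilon (inhabits (@vzero d)) (is_prox h eta x).

Definition favg d n (f : 'I_n -> vec d -> R) (x : vec d) : R :=
  / INR n * rsum (fun a : 'I_n => f a x).
Definition gavg d n (g : 'I_n -> vec d -> vec d) (x : vec d) : vec d :=
  fun k => / INR n * rsum (fun a : 'I_n => g a x k).
Definition Pobj d n (f : 'I_n -> vec d -> R) (h : vec d -> ereal) (x : vec d) : ereal :=
  eaddr (h x) (favg f x).

Definition gmap d n (g : 'I_n -> vec d -> vec d) (h : vec d -> ereal) (eta : R) (x : vec d)
  : vec d :=
  vscale (1 / eta) (vsub x (prox h eta (vsub x (vscale eta (gavg g x))))).

(** * The stochastic quantizer Q_(delta,b); the random choice is a bit
   (true = round up to z + delta).  qprob gives the probability of the bit. *)
Definition qlo (delta : R) (b : nat) : R := - (2 ^ b.-1) * delta.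
Definition qhi (delta : R) (b : nat) : R := (2 ^ b.-1 - 1) * delta.
Definition qfloor (delta x : R) : R := IZR (Int_part (x / delta)) * delta.
Definition qval (delta : R) (b : nat) (x : R) (bit : bool) : R :=
  if Req_EM_T delta 0 then 0 else
  if Rlt_dec x (qlo delta b) then qlo delta b else
  if Rlt_dec (qhi delta b) x then qhi delta b else
  if bit then qfloor delta x + delta else qfloor delta x.
Definition qprob (delta : R) (b : nat) (x : R) (bit : bool) : R :=
  if Req_EM_T delta 0 then (if bit then 0 else 1) else
  if Rlt_dec x (qlo delta b) then (if bit then 0 else 1) else
  if Rlt_dec (qhi delta b) x then (if bit then 0 else 1) else
  if bit then (x - qfloor delta x) / delta
  else (qfloor delta x + delta - x) / delta.
Definition qvec d (delta : R) (b : nat) (x : vec d) (bits : {ffun 'I_d -> bool}) : vec d :=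
  fun k => qval delta b (x k) (bits k).
Definition qvprob d (delta : R) (b : nat) (x : vec d) (bits : {ffun 'I_d -> bool}) : R :=
  rprod (fun k : 'I_d => qprob delta b (x k) (bits k)).
Definition outside (delta : R) (b : nat) (x : R) : bool :=
  if Rlt_dec x (qlo delta b) then true else
  if Rlt_dec (qhi delta b) x then true else false.

Inductive scheme := SchA | SchB | SchC.

Section LPCSVRG.
Variables (d n N B m b : nat).
Variable g : 'I_n -> vec d -> vec d.      (* gradients of the f_i *)
Variable h : vec d -> ereal.
Variables (eta lam : R).
Variable sch : scheme.

(** u_t^i for worker with sampled multiset I (B indices) *)
Definition uvec (xt x : vec d) (I : {ffun 'I_B -> 'I_n}) : vec d :=
  fun k => / INR B * rsum (fun a : 'I_B => g (I a) x k - g (I a) xt k).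
Definition qscale (u : vec d) : R := lam * ninf u / (2 ^ b.-1 - 1).
Definition dmax (u : 'I_N -> vec d) : R := \big[Rmax/R0]_(j : 'I_N) qscale (u j).
Definition wscale (u : 'I_N -> vec d) (i : 'I_N) : R :=
  match sch with SchA => qscale (u i) | _ => dmax u end.
Definition avgq (u : 'I_N -> vec d) (bits : {ffun 'I_N -> {ffun 'I_d -> bool}}) : vec d :=
  fun k => / INR N * rsum (fun i : 'I_N => qvec (wscale u i) b (u i) (bits i) k).
Definition utilde (u : 'I_N -> vec d) (bits : {ffun 'I_N -> {ffun 'I_d -> bool}}) (bits2 : {ffun 'I_d -> bool}) : vec d :=
  match sch with
  | SchC => qvec (dmax u) b (avgq u bits) bits2
  | _ => avgq u bits
  end.
Definition qweight (u : 'I_N -> vec d) (bits : {ffun 'I_N -> {ffun 'I_d -> bool}}) (bits2 : {ffun 'I_d -> bool}) : R :=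
  rprod (fun i : 'I_N => qvprob (wscale u i) b (u i) (bits i)) *
  match sch with
  | SchC => qvprob (dmax u) b (avgq u bits) bits2
  | _ => rprod (fun k : 'I_d => if bits2 k then 0 else 1)  (* bits2 unused *)
  end.

(** state = (x~^s, x_t^{s+1}); global step j = s*m + t *)
Definition ustate (st : vec d * vec d) (I : {ffun 'I_N -> {ffun 'I_B -> 'I_n}}) :
  'I_N -> vec d := fun i => uvec st.1 st.2 (I i).
Definition weight (st : vec d * vec d) (I : {ffun 'I_N -> {ffun 'I_B -> 'I_n}})
  (bits : {ffun 'I_N -> {ffun 'I_d -> bool}}) (bits2 : {ffun 'I_d -> bool}) : R :=
  (/ INR n) ^ (N * B)%N * qweight (ustate st I) bits bits2.
Definition step (j : nat) (st : vec d * vec d) (I : {ffun 'I_N -> {ffun 'I_B -> 'I_n}})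
  (bits : {ffun 'I_N -> {ffun 'I_d -> bool}}) (bits2 : {ffun 'I_d -> bool}) : vec d * vec d :=
  let v := vadd (utilde (ustate st I) bits bits2) (gavg g st.1) in
  let x' := prox h eta (vsub st.2 (vscale eta v)) in
  if (j %% m == m.-1)%N then (x', x') else (st.1, x').

(** Eval k j F st = E[F(state at time j+k) | state at time j is st] *)
Fixpoint Eval (k j : nat) (F : vec d * vec d -> R) (st : vec d * vec d) : R :=
  match k with
  | O => F st
  | S k' => rsum (fun I : {ffun 'I_N -> {ffun 'I_B -> 'I_n}} =>
             rsum (fun bits : {ffun 'I_N -> {ffun 'I_d -> bool}} =>
             rsum (fun bits2 : {ffun 'I_d -> bool} =>
               weight st I bits bits2 * Eval k' (S j) F (step j st I bits bits2))))
  end.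

Variable x0 : vec d.
Inductive reach : nat -> vec d * vec d -> Prop :=
| reach0 : reach 0 (x0, x0)
| reachS j st (I : {ffun 'I_N -> {ffun 'I_B -> 'I_n}})
    (bits : {ffun 'I_N -> {ffun 'I_d -> bool}}) (bits2 : {ffun 'I_d -> bool}) : reach j st -> 0 < weight st I bits bits2 ->
    reach (S j) (step j st I bits bits2).

Definition n_outside (st : vec d * vec d) (I : {ffun 'I_N -> {ffun 'I_B -> 'I_n}})
  (i : 'I_N) : nat :=
  #|[pred k : 'I_d | outside (wscale (ustate st I) i) b (ustate st I i k)]|.

(** E ||G_eta(x_out)||^2, x_out uniform among the T = S*m iterates x_t^{s+1} *)
Definition expected_gmap (S : nat) : R :=
  / INR (S * m) * rsum (fun j : 'I_(S * m) =>
    Eval j 0 (fun st => nrm2 (gmap g h eta st.2)) (x0, x0)).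
End LPCSVRG.

(* Main.v *)
Require Import Defs.
From HB Require Import structures.
From Stdlib Require Import Reals Lra Psatz ClassicalEpsilon FunctionalExtensionality.
From mathcomp Require Import all_boot.
Set Implicit Arguments. Unset Strict Implicit. Unset Printing Implicit Defensive.
Local Open Scope R_scope.

(** Write xb for the exact proximal step from x, x' for the step taken with the direction v, and
    e := v - grad f(x). The variational inequalities of the two proximal points (at xb for x', at x
    for xb) and the descent lemma give
      P(x') <= P(x) + eta/2 |e|^2 - eta/2 |G_eta(x)|^2 - (1 - rho)/(2 eta) |x' - x|^2.
    All u_t^i have norm at most L |x - xt|, xt being the snapshot. The quantization error is bounded
    pointwise, by one grid step inside the representable range and by the clipping distance outside;
    only the sampling error needs independence. Together E|e|^2 <= 16 Gamma L^2 |x - xt|^2, where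
    Gamma is the bracket of the step size condition. Within an epoch |x_t - xt|^2 is at most t times
    the sum of the squared step lengths, so the accumulated error is absorbed by the terms
    -(1 - rho)/(2 eta) |x' - x|^2 because 8 m^2 rho^2 Gamma <= 1 - rho; the rest telescopes.
    Proximal points exist because P is bounded below and eta < 1/(2L). *)

(** * Algebraic structures on the reals for iterated sums and products *)

Lemma Rplus_associative : associative Rplus.
Proof. by move=> x y z; ring. Qed.
Lemma Rplus_commutative : commutative Rplus.
Proof. by move=> x y; ring. Qed.
Lemma Rplus_left_id : left_id R0 Rplus.
Proof. by move=> x; ring. Qed.
HB.instance Definition _ :=
  Monoid.isComLaw.Build R R0 Rplus Rplus_associative Rplus_commutative Rplus_left_id.

Lemma Rmult_associative : associative Rmult.
Proof. by move=> x y z; ring. Qed.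
Lemma Rmult_commutative : commutative Rmult.
Proof. by move=> x y; ring. Qed.
Lemma Rmult_left_id : left_id R1 Rmult.
Proof. by move=> x; ring. Qed.
HB.instance Definition _ :=
  Monoid.isComLaw.Build R R1 Rmult Rmult_associative Rmult_commutative Rmult_left_id.

Lemma Rmult_left_zero : left_zero R0 Rmult.
Proof. by move=> x; ring. Qed.
Lemma Rmult_right_zero : right_zero R0 Rmult.
Proof. by move=> x; ring. Qed.
HB.instance Definition _ := Monoid.isMulLaw.Build R R0 Rmult Rmult_left_zero Rmult_right_zero.

Lemma Rmult_left_distributive : left_distributive Rmult Rplus.
Proof. by move=> x y z; ring. Qed.
Lemma Rmult_right_distributive : right_distributive Rmult Rplus.
Proof. by move=> x y z; ring. Qed.
HB.instance Definition _ :=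
  Monoid.isAddLaw.Build R Rmult Rplus Rmult_left_distributive Rmult_right_distributive.

(** * Finite sums, products and maxima of reals *)

Section FiniteSums.
Variable T : finType.
Implicit Types F G : T -> R.

Lemma eq_rsum F G : (forall t, F t = G t) -> rsum F = rsum G.
Proof. by move=> e; apply: eq_bigr => t _; apply: e. Qed.

Lemma rsumD F G : rsum (fun t => F t + G t) = rsum F + rsum G.
Proof. exact: big_split. Qed.

Lemma rsumZ c F : rsum (fun t => c * F t) = c * rsum F.
Proof. by rewrite /rsum big_distrr. Qed.

Lemma rsumZr c F : rsum (fun t => F t * c) = rsum F * c.
Proof. by rewrite /rsum big_distrl. Qed.

Lemma rsumN F : rsum (fun t => - F t) = - rsum F.
Proof.
by rewrite -[RHS]Rmult_1_l -Ropp_mult_distr_r Ropp_mult_distr_l -rsumZ; apply: eq_rsum => t; ring.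
Qed.

Lemma rsumB F G : rsum (fun t => F t - G t) = rsum F - rsum G.
Proof. by rewrite /Rminus rsumD rsumN. Qed.

Lemma ler_rsum F G : (forall t, F t <= G t) -> rsum F <= rsum G.
Proof.
move=> le; rewrite /rsum; elim/big_rec2: _ => [|t x y _ ?]; first exact: Rle_refl.
by have := le t; lra.
Qed.

Lemma rsum_ge0 F : (forall t, 0 <= F t) -> 0 <= rsum F.
Proof.
move=> ge; rewrite /rsum; elim/big_rec: _ => [|t x _ ?]; first exact: Rle_refl.
by have := ge t; lra.
Qed.

Lemma rsum_const c : rsum (fun _ : T => c) = INR #|T| * c.
Proof.
rewrite /rsum big_const; elim: #|_| => [|k IH]; first by rewrite /= Rmult_0_l.
by rewrite iterS IH S_INR; ring.
Qed.

Lemma rsum0 F : (forall t, F t = 0) -> rsum F = 0.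
Proof. by move=> e; rewrite (eq_rsum e) rsum_const Rmult_0_r. Qed.

Lemma rsum_pick F t0 : (forall t, t != t0 -> F t = 0) -> rsum F = F t0.
Proof.
move=> e; rewrite /rsum (bigD1 t0) //= big1; first by rewrite Rplus_0_r.
by move=> t /e.
Qed.

Lemma rprod_ge0 F : (forall t, 0 <= F t) -> 0 <= rprod F.
Proof.
move=> ge; rewrite /rprod; elim/big_rec: _ => [|t x _ ?]; first exact: Rle_0_1.
exact: Rmult_le_pos.
Qed.

Lemma rprod1 F : (forall t, F t = 1) -> rprod F = 1.
Proof. by move=> e; rewrite /rprod big1. Qed.

Lemma rprod0 F t0 : F t0 = 0 -> rprod F = 0.
Proof. by move=> e; rewrite /rprod (bigD1 t0) //= e Rmult_0_l. Qed.

Lemma rprod_const c : rprod (fun _ : T => c) = c ^ #|T|.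
Proof. by rewrite /rprod big_const; elim: #|_| => [//|k IH]; rewrite iterS IH. Qed.

Lemma rprodM F G : rprod (fun t => F t * G t) = rprod F * rprod G.
Proof. exact: big_split. Qed.

Lemma rprod_pick F t0 : (forall t, t != t0 -> F t = 1) -> rprod F = F t0.
Proof.
move=> e; rewrite /rprod (bigD1 t0) //= big1; first by rewrite Rmult_1_r.
by move=> t /e.
Qed.

Lemma le_bigRmax F t : F t <= \big[Rmax/R0]_s F s.
Proof.
have : t \in index_enum T by exact: mem_index_enum.
elim: (index_enum T) => [//|s r IH]; rewrite inE big_cons => /orP [/eqP ->|/IH le].
  exact: Rmax_l.
exact: Rle_trans le (Rmax_r _ _).
Qed.

Lemma bigRmax_le F c : 0 <= c -> (forall t, F t <= c) -> \big[Rmax/R0]_s F s <= c.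
Proof.
move=> c0 le; elim/big_rec: _ => [//|s x _ ?]; exact: Rmax_lub.
Qed.

Lemma bigRmax_ge0 F : 0 <= \big[Rmax/R0]_s F s.
Proof.
elim/big_rec: _ => [|s x _ ?]; first exact: Rle_refl.
exact: Rle_trans (Rmax_r _ _).
Qed.

(** The sum of the squares of [F t - c * G t] is a nonnegative quadratic in [c]. Its minimizer
    [c = a / q] gives the claim when [q > 0]. *)
Lemma Cauchy_Schwarz F G :
  rsum (fun t => F t * G t) * rsum (fun t => F t * G t) <=
  rsum (fun t => F t * F t) * rsum (fun t => G t * G t).
Proof.
set a := rsum _; set p := rsum _; set q := rsum _.
have p0 : 0 <= p by apply: rsum_ge0 => t; nra.
have q0 : 0 <= q by apply: rsum_ge0 => t; nra.
have key c : 0 <= p - 2 * c * a + c * c * q.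
  rewrite /a /p /q -!rsumZ -rsumB -rsumD; apply: rsum_ge0 => t.
  by have := Rle_0_sqr (F t - c * G t); rewrite /Rsqr; lra.
case: (Rle_lt_or_eq_dec 0 q q0) => [qp|q00].
  have := key (a / q).
  have -> : p - 2 * (a / q) * a + a / q * (a / q) * q = (p * q - a * a) / q by field; lra.
  move=> H; have := Rmult_le_pos _ _ H q0.
  have -> : (p * q - a * a) / q * q = p * q - a * a by field; lra.
  lra.
rewrite -q00 in key *.
have a0 : a = 0.
  (* For [q = 0] the quadratic degenerates to [p - 2 * c * a]; this [c] would give it the value
     -1. *)
  case: (Req_dec a 0) => // an0; have := key ((p + 1) * / (2 * a)).
  have -> : 2 * ((p + 1) * / (2 * a)) * a = p + 1 by field.
  lra.
by rewrite a0; lra.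
Qed.

Lemma sqr_rsum_le F : rsum F * rsum F <= INR #|T| * rsum (fun t => F t * F t).
Proof.
have := Cauchy_Schwarz (fun _ => 1) F.
rewrite (rsum_const (1 * 1)) (eq_rsum (G := F)); last by move=> t; ring.
lra.
Qed.

End FiniteSums.

(** * Sums over function spaces, read as expectations over independent draws *)

Lemma rsum_exchange (S T : finType) (F : S -> T -> R) :
  rsum (fun s => rsum (F s)) = rsum (fun t => rsum (fun s => F s t)).
Proof. exact: exchange_big. Qed.

Lemma rsum_pair (S T : finType) (F : S -> T -> R) :
  rsum (fun s => rsum (F s)) = rsum (fun st : S * T => F st.1 st.2).
Proof. exact: pair_bigA. Qed.

(** Independence in finite form: under a product weight, the expectation of a product of functions
    of single coordinates factorizes. *)
Lemma rsum_ffun_rprod (S T : finType) (F : S -> T -> R) :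
  rsum (fun I : {ffun S -> T} => rprod (fun s => F s (I s))) =
  rprod (fun s => rsum (F s)).
Proof. by rewrite /rsum /rprod bigA_distr_bigA. Qed.

(** The variance of a sum of independent centred variables: after the square is expanded, a cross
    term factorizes and its factor at [r] is the mean of [X], which is 0. *)
Lemma rsum_ffun_variance (S T : finType) (w X : T -> R) :
  rsum w = 1 -> rsum (fun t => w t * X t) = 0 ->
  rsum (fun I : {ffun S -> T} =>
    rprod (fun s => w (I s)) * (rsum (fun s => X (I s)) * rsum (fun s => X (I s)))) =
  INR #|S| * rsum (fun t => w t * (X t * X t)).
Proof.
move=> w1 wX.
(* Padding with 1 away from [r] writes [X (I r)] as a product over all coordinates, the form that
   factorization requires. *)
pose Y (s r : S) t := if s == r then X t else 1.
have YE (I : {ffun S -> T}) r : rprod (fun s => Y s r (I s)) = X (I r).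
  rewrite (rprod_pick (t0 := r)) /Y ?eqxx // => s /negbTE -> //.
transitivity (rsum (fun r => rsum (fun r' => rsum (fun I : {ffun S -> T} =>
    rprod (fun s => w (I s) * (Y s r (I s) * Y s r' (I s))))))).
  rewrite [RHS](eq_rsum (G := fun r => rsum (fun I : {ffun S -> T} => rsum (fun r' =>
    rprod (fun s => w (I s) * (Y s r (I s) * Y s r' (I s))))))); last first.
    by move=> r; rewrite rsum_exchange.
  rewrite rsum_exchange; apply: eq_rsum => I.
  rewrite -rsumZr -rsumZ; apply: eq_rsum => r.
  rewrite -rsumZ -rsumZ; apply: eq_rsum => r'.
  by rewrite !rprodM !YE.
rewrite -(rsum_const S); apply: eq_rsum => r.
rewrite (rsum_pick (t0 := r)).
  rewrite (rsum_ffun_rprod (fun s t => w t * (Y s r t * Y s r t))).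
  rewrite (rprod_pick (t0 := r)) => [|s /negbTE sr].
    by apply: eq_rsum => t; rewrite /Y eqxx.
  by rewrite -w1; apply: eq_rsum => t; rewrite /Y sr; ring.
move=> r' /negbTE r'r.
rewrite (rsum_ffun_rprod (fun s t => w t * (Y s r t * Y s r' t))).
apply: (rprod0 (t0 := r)).
by rewrite -wX; apply: eq_rsum => t; rewrite /Y eqxx eq_sym r'r; ring.
Qed.

Lemma rsum_ffun_rprod1 (S T : finType) (w : S -> T -> R) :
  (forall s, rsum (w s) = 1) ->
  rsum (fun I : {ffun S -> T} => rprod (fun s => w s (I s))) = 1.
Proof. by move=> w1; rewrite rsum_ffun_rprod rprod1. Qed.

Lemma rsum_ffun_rprod_centred (S T : finType) (w X : T -> R) :
  rsum w = 1 -> rsum (fun t => w t * X t) = 0 ->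
  rsum (fun I : {ffun S -> T} => rprod (fun s => w (I s)) * rsum (fun s => X (I s))) = 0.
Proof.
move=> w1 wX.
pose Y (s r : S) t := if s == r then X t else 1.
transitivity (rsum (fun r => rsum (fun I : {ffun S -> T} =>
    rprod (fun s => w (I s) * Y s r (I s))))).
  rewrite rsum_exchange; apply: eq_rsum => I; rewrite -rsumZ; apply: eq_rsum => r.
  rewrite rprodM (rprod_pick (F := fun s => Y s r (I s)) (t0 := r)) /Y ?eqxx // => s /negbTE -> //.
apply: rsum0 => r; rewrite (rsum_ffun_rprod (fun s t => w t * Y s r t)).
apply: (rprod0 (t0 := r)).
by rewrite -wX; apply: eq_rsum => t; rewrite /Y eqxx.
Qed.

(** * Euclidean and sup norms *)

Section Vectors.
Variable d : nat.
Implicit Types x y z v : vec d.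

Lemma nrm2_ge0 x : 0 <= nrm2 x.
Proof. by apply: rsum_ge0 => k; nra. Qed.

Lemma nrm_sqr x : nrm x * nrm x = nrm2 x.
Proof. exact/sqrt_sqrt/nrm2_ge0. Qed.

Lemma nrm_ge0 x : 0 <= nrm x.
Proof. exact: sqrt_pos. Qed.

Lemma dot_le_nrm x y : dot x y <= nrm x * nrm y.
Proof.
apply: Rsqr_incr_0_var; last exact: Rmult_le_pos (nrm_ge0 _) (nrm_ge0 _).
rewrite /Rsqr; have -> : nrm x * nrm y * (nrm x * nrm y) = nrm2 x * nrm2 y.
  by rewrite -!nrm_sqr; ring.
exact: Cauchy_Schwarz.
Qed.

Lemma Young c x y : 0 < c -> dot x y <= c / 2 * nrm2 x + / (2 * c) * nrm2 y.
Proof.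
move=> c0.
suff : 0 <= c / 2 * nrm2 x + / (2 * c) * nrm2 y - dot x y by lra.
rewrite /nrm2 /dot -!rsumZ -rsumD -rsumB; apply: rsum_ge0 => k.
have -> : c / 2 * (x k * x k) + / (2 * c) * (y k * y k) - x k * y k =
  / (2 * c) * ((c * x k - y k) * (c * x k - y k)) by field; lra.
apply: Rmult_le_pos; last exact: Rle_0_sqr.
by apply/Rlt_le/Rinv_0_lt_compat; lra.
Qed.

Lemma nrm2_subC x y : nrm2 (vsub x y) = nrm2 (vsub y x).
Proof. by apply: eq_rsum => k; rewrite /vsub; ring. Qed.

Lemma nrm2_subxx x : nrm2 (vsub x x) = 0.
Proof. by apply: rsum0 => k; rewrite /vsub; ring. Qed.

Lemma sqr_coord_le x k : x k * x k <= nrm2 x.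
Proof.
rewrite /nrm2 /dot /rsum (bigD1 k) //=.
rewrite -[X in X <= _]Rplus_0_r; apply: Rplus_le_compat_l.
elim/big_rec: _ => [|i r _ ?]; [exact: Rle_refl|].
by have := Rle_0_sqr (x i); rewrite /Rsqr; lra.
Qed.

Lemma Rabs_coord_le x k : Rabs (x k) <= nrm x.
Proof.
rewrite -sqrt_Rsqr_abs; apply: sqrt_le_1_alt; exact: sqr_coord_le.
Qed.

Lemma ninf_le_nrm x : ninf x <= nrm x.
Proof. by apply: bigRmax_le => [|k]; [exact: nrm_ge0 | exact: Rabs_coord_le]. Qed.

Lemma Rabs_coord_le_ninf x k : Rabs (x k) <= ninf x.
Proof. exact: (le_bigRmax (fun k => Rabs (x k))). Qed.

Lemma ninf_ge0 x : 0 <= ninf x.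
Proof. exact: bigRmax_ge0. Qed.

Lemma nrm2_le_sqr x c : nrm x <= c -> nrm2 x <= c * c.
Proof. by rewrite -nrm_sqr => le; have := nrm_ge0 x; nra. Qed.

Lemma nrm_le_of_sqr x c : 0 <= c -> nrm2 x <= c * c -> nrm x <= c.
Proof.
move=> c0 le; rewrite -(sqrt_square c) //; exact: sqrt_le_1_alt.
Qed.

End Vectors.

(** * Gradients along lines and the descent lemma *)

Section Smoothness.
Variables (d : nat) (f : vec d -> R) (g : vec d -> vec d).
Hypothesis fg : has_gradient f g.

Lemma nrm_vscale (t : R) (v : vec d) : nrm (vscale t v) = Rabs t * nrm v.
Proof.
rewrite /nrm; have -> : nrm2 (vscale t v) = Rsqr t * nrm2 v.
  by rewrite /nrm2 /dot -rsumZ; apply: eq_rsum => k; rewrite /vscale /Rsqr; ring.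
rewrite sqrt_mult; [by rewrite sqrt_Rsqr_abs | exact: Rle_0_sqr | exact: nrm2_ge0].
Qed.

Lemma derivable_along_line (x v : vec d) (t : R) :
  derivable_pt_lim (fun s => f (vadd x (vscale s v))) t (dot (g (vadd x (vscale t v))) v).
Proof.
move=> eps eps0; set z := vadd x (vscale t v).
have v0 := nrm_ge0 v.
(* The [+ 1] covers [v = 0]; the factor 2 leaves a margin for turning the weak inequality of
   [has_gradient] into a strict one. *)
have eps'0 : 0 < eps / (2 * (nrm v + 1)) by apply: Rdiv_lt_0_compat; lra.
have [del [del0 H]] := fg z eps'0.
have del'0 : 0 < del / (nrm v + 1) by apply: Rdiv_lt_0_compat; lra.
exists (mkposreal _ del'0) => s s0 /= sdel.
have sE : vsub (vadd x (vscale (t + s) v)) z = vscale s v.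
  by apply: functional_extensionality => k; rewrite /vsub /z /vadd /vscale; ring.
have as0 : 0 < Rabs s by exact: Rabs_pos_lt.
have close : nrm (vsub (vadd x (vscale (t + s) v)) z) < del.
  rewrite sE nrm_vscale.
  apply: (Rle_lt_trans _ (Rabs s * (nrm v + 1))); first nra.
  have -> : del = del / (nrm v + 1) * (nrm v + 1) by field; lra.
  by apply: Rmult_lt_compat_r; lra.
have := H _ close; rewrite sE nrm_vscale.
have -> : dot (g z) (vscale s v) = s * dot (g z) v.
  by rewrite /dot -rsumZ; apply: eq_rsum => k; rewrite /vscale; ring.
set A := f _ - f z => le.
have -> : A / s - dot (g z) v = (A - s * dot (g z) v) / s by field.
rewrite /Rdiv Rabs_mult Rabs_inv.
apply: (Rle_lt_trans _ (eps / (2 * (nrm v + 1)) * (Rabs s * nrm v) * / Rabs s)).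
  by apply: Rmult_le_compat_r => //; apply/Rlt_le/Rinv_0_lt_compat.
have -> : eps / (2 * (nrm v + 1)) * (Rabs s * nrm v) * / Rabs s =
  eps * (nrm v / (2 * (nrm v + 1))) by field; lra.
have : nrm v / (2 * (nrm v + 1)) < 1.
  by apply: (Rmult_lt_reg_r (2 * (nrm v + 1))); [lra | field_simplify; lra].
by nra.
Qed.

(** On the segment from [x] to [y], [psi] is [f] minus the terms of the claimed bound that vary. The
    Lipschitz condition and Cauchy-Schwarz make its derivative nonpositive on (0, 1), so the mean
    value theorem suffices and no integral is taken. *)
Lemma descent_lemma (L : R) (x y : vec d) :
  (forall x y, nrm (vsub (g x) (g y)) <= L * nrm (vsub x y)) ->
  f y <= f x + dot (g x) (vsub y x) + L / 2 * nrm2 (vsub y x).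
Proof.
move=> gL; set v := vsub y x.
pose psi := fun s => f (vadd x (vscale s v)) - (dot (g x) v * s + L / 2 * nrm2 v * (s * s)).
pose psi' := fun s => dot (g (vadd x (vscale s v))) v -
  (dot (g x) v * 1 + L / 2 * nrm2 v * (1 * s + s * 1)).
have D s : derivable_pt_lim psi s (psi' s).
  apply: (derivable_pt_lim_minus (fun s => f (vadd x (vscale s v)))
    (fun s => dot (g x) v * s + L / 2 * nrm2 v * (s * s))); first exact: derivable_along_line.
  apply: (derivable_pt_lim_plus (fun s => dot (g x) v * s)
    (fun s => L / 2 * nrm2 v * (s * s))).
    exact: (derivable_pt_lim_scal id _ _ 1 (derivable_pt_lim_id _)).
  apply: (derivable_pt_lim_scal (fun s => s * s)).
  exact: (derivable_pt_lim_mult id id _ _ _ (derivable_pt_lim_id _) (derivable_pt_lim_id _)).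
have [c [E [c0 c1]]] := MVT_cor2 psi psi' 0 1 Rlt_0_1 (fun s _ => D s).
have psi'0 : psi' c <= 0.
  rewrite /psi'; set z := vadd _ _.
  have -> : dot (g z) v - (dot (g x) v * 1 + L / 2 * nrm2 v * (1 * c + c * 1)) =
    dot (vsub (g z) (g x)) v - L * c * nrm2 v.
    have -> : dot (vsub (g z) (g x)) v = dot (g z) v - dot (g x) v.
      by rewrite /dot -rsumB; apply: eq_rsum => k; rewrite /vsub; ring.
    by field.
  have := dot_le_nrm (vsub (g z) (g x)) v.
  have := gL z x.
  have -> : vsub z x = vscale c v.
    by apply: functional_extensionality => k; rewrite /vsub /z /vadd /vscale; ring.
  rewrite nrm_vscale Rabs_pos_eq; last lra.
  by rewrite -nrm_sqr; have := nrm_ge0 v; nra.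
move: E; rewrite /psi.
have -> : vadd x (vscale 1 v) = y.
  by apply: functional_extensionality => k; rewrite /v /vsub /vadd /vscale; ring.
have -> : vadd x (vscale 0 v) = x.
  by apply: functional_extensionality => k; rewrite /v /vsub /vadd /vscale; ring.
lra.
Qed.

End Smoothness.

Lemma descent_lemma_avg d n (f : 'I_n -> vec d -> R) (g : 'I_n -> vec d -> vec d) (L : R) :
  (0 < n)%N -> (forall a, has_gradient (f a) (g a)) ->
  (forall a x y, nrm (vsub (g a x) (g a y)) <= L * nrm (vsub x y)) ->
  forall x y, favg f y <= favg f x + dot (gavg g x) (vsub y x) + L / 2 * nrm2 (vsub y x).
Proof.
move=> n0 fg gL x y.
have nR : 0 < INR n by apply: lt_0_INR; apply/ltP.
have -> : dot (gavg g x) (vsub y x) = / INR n * rsum (fun a => dot (g a x) (vsub y x)).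
  rewrite /dot rsum_exchange -rsumZ; apply: eq_rsum => k.
  by rewrite rsumZr /gavg Rmult_assoc.
have -> : L / 2 * nrm2 (vsub y x) = / INR n * rsum (fun a : 'I_n => L / 2 * nrm2 (vsub y x)).
  by rewrite rsum_const card_ord; field; lra.
rewrite /favg -!Rmult_plus_distr_l -!rsumD.
apply: Rmult_le_compat_l; first exact/Rlt_le/Rinv_0_lt_compat.
by apply: ler_rsum => a; apply: descent_lemma.
Qed.

(** * Proximal points: variational inequality and existence *)

Lemma Un_cv_rsum (T : finType) (F : nat -> T -> R) (l : T -> R) :
  (forall t, Un_cv (fun k => F k t) (l t)) -> Un_cv (fun k => rsum (F k)) (rsum l).
Proof.
move=> cv; rewrite /rsum; elim: (index_enum T) => [|t r IH].
  rewrite big_nil => eps eps0; exists O => k _.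
  by rewrite big_nil R_dist_eq.
rewrite big_cons => eps eps0.
have [K HK] := CV_plus _ _ _ _ (cv t) IH eps eps0.
by exists K => k kK; rewrite big_cons; apply: HK.
Qed.

Lemma Un_cv_cst (c : R) : Un_cv (fun _ => c) c.
Proof. by move=> eps eps0; exists O => k _; rewrite R_dist_eq. Qed.

Lemma Un_cv_nrm2_sub d (y : nat -> vec d) (p x : vec d) :
  (forall i, Un_cv (fun k => y k i) (p i)) ->
  Un_cv (fun k => nrm2 (vsub (y k) x)) (nrm2 (vsub p x)).
Proof.
move=> cv; apply: Un_cv_rsum => i.
have sub : Un_cv (fun k => y k i - x i) (p i - x i).
  by apply: CV_minus => //; exact: Un_cv_cst.
exact: CV_mult.
Qed.

Section Prox.
Variables (d : nat) (h : vec d -> ereal) (eta : R) (x : vec d).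
Hypothesis eta0 : 0 < eta.
Hypothesis convh : convex_fun h.

Lemma is_prox_finite p : proper_fun h -> is_prox h eta x p -> exists r, h p = EFin r.
Proof.
move=> [z [r hz]] /(_ z); rewrite hz; case: (h p) => [r' _|//]; by exists r'.
Qed.

(** First-order optimality: [p] is compared with the point at fraction [th] of the way to [z], and
    the inequality is divided by [th]. Instead of a limit, a violation [gap] is refuted with one
    explicit small [th]. *)
Lemma prox_variational p z hp hz : is_prox h eta x p -> h p = EFin hp -> h z = EFin hz ->
  hp <= hz + dot (vsub x p) (vsub p z) / eta.
Proof.
move=> Pp Ep Ez.
apply: Rnot_lt_le => lt.
set D := dot _ _ in lt; set gap := hp - (hz + D / eta).
have gap0 : 0 < gap by rewrite /gap; lra.
set Q := nrm2 (vsub z p); have Q0 : 0 <= Q by exact: nrm2_ge0.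
(* Small enough that the second-order term [th * Q / (2 * eta)] stays below [gap]; the [+ 1] covers
   [Q = 0]. *)
pose th := Rmin 1 (eta * gap / (Q + 1)).
have th0 : 0 < th.
  by apply: Rmin_glb_lt; [lra | apply: Rdiv_lt_0_compat; nra].
have th1 : th <= 1 by exact: Rmin_l.
have thQ : th * Q < 2 * (eta * gap).
  have le : th <= eta * gap / (Q + 1) by exact: Rmin_r.
  have : th * (Q + 1) <= eta * gap.
    have -> : eta * gap = eta * gap / (Q + 1) * (Q + 1) by field; lra.
    by apply: Rmult_le_compat_r; lra.
  by nra.
have thb : 0 <= th <= 1 by lra.
have := convh Ez Ep thb.
set y := vadd _ _ => ley; have := Pp y.
rewrite Ep; move: ley; case: (h y) => //= hy ley.
have -> : nrm2 (vsub y x) = nrm2 (vsub p x) + 2 * th * D + th * th * Q.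
  rewrite /nrm2 /D /Q /nrm2 /dot -!rsumZ -!rsumD; apply: eq_rsum => k.
  by rewrite /y /vsub /vadd /vscale; ring.
rewrite !Rdiv_plus_distr => le.
have e1 : 2 * th * D / (2 * eta) = th * (D / eta) by field; lra.
have e2 : th * th * Q / (2 * eta) = th * (th * Q / (2 * eta)) by field; lra.
have lt2 : th * Q / (2 * eta) < gap.
  apply: (Rmult_lt_reg_r (2 * eta)); first lra.
  have -> : th * Q / (2 * eta) * (2 * eta) = th * Q by field; lra.
  lra.
have : th * (hp - hz - D / eta - th * Q / (2 * eta)) <= 0 by lra.
have : 0 < hp - hz - D / eta - th * Q / (2 * eta) by rewrite /gap in lt2; lra.
by nra.
Qed.

(* Strong convexity makes every minimizing sequence Cauchy, so no compactness is needed. *)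
Lemma prox_exists : proper_fun h -> lsc_fun h ->
  (exists lb, forall y r, h y = EFin r -> lb <= r + nrm2 (vsub y x) / (2 * eta)) ->
  exists p, is_prox h eta x p.
Proof.
move=> [z0 [r0 hz0]] lsch [lb lbP].
(* The objective values are negated because [completeness] provides suprema; the infimum is then
   [I = - M]. *)
pose E v := exists y r, h y = EFin r /\ v = - (r + nrm2 (vsub y x) / (2 * eta)).
have Eb : bound E.
  by exists (- lb) => v [y [r [/lbP le ->]]]; lra.
have Ei : exists v, E v by exists (- (r0 + nrm2 (vsub z0 x) / (2 * eta))), z0, r0.
have [M [Mub Mlub]] := completeness E Eb Ei.
pose I := - M.
have Ile y r : h y = EFin r -> I <= r + nrm2 (vsub y x) / (2 * eta).
  move=> hy; suff : - (r + nrm2 (vsub y x) / (2 * eta)) <= M by rewrite /I; lra.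
  by apply: Mub; exists y, r.
have near k : exists yr : vec d * R, h yr.1 = EFin yr.2 /\
    yr.2 + nrm2 (vsub yr.1 x) / (2 * eta) < I + / (INR k + 1).
  apply: NNPP => no.
  have pk : 0 < / (INR k + 1) by apply: Rinv_0_lt_compat; have := pos_INR k; lra.
  have : M <= M - / (INR k + 1).
    apply: Mlub => v [y [r [hy ->]]].
    apply: Rnot_lt_le => lt; apply: no; exists (y, r); split => //=.
    by rewrite /I; lra.
  lra.
pose yr k := proj1_sig (constructive_indefinite_description _ (near k)).
have yrP k : h (yr k).1 = EFin (yr k).2 /\
    (yr k).2 + nrm2 (vsub (yr k).1 x) / (2 * eta) < I + / (INR k + 1).
  by rewrite /yr; case: constructive_indefinite_description.
pose y k := (yr k).1.
(* The parallelogram identity at the midpoint: its objective value is at least [I] but falls below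
   the mean of the two values by [nrm2 (vsub (y k) (y l)) / (8 * eta)] or more. *)
have dist k l : nrm2 (vsub (y k) (y l)) <= 4 * eta * (/ (INR k + 1) + / (INR l + 1)).
  have [hk lk] := yrP k; have [hl ll] := yrP l.
  have half : 0 <= 1 / 2 <= 1 by lra.
  have := convh hk hl half; rewrite -/(y k) -/(y l).
  set mid := vadd _ _; case Em : (h mid) => [rm|] //= lem.
  have := Ile _ _ Em.
  have -> : nrm2 (vsub mid x) = / 2 * nrm2 (vsub (y k) x) + / 2 * nrm2 (vsub (y l) x)
      + - / 4 * nrm2 (vsub (y k) (y l)).
    rewrite /nrm2 /dot -!rsumZ -!rsumD; apply: eq_rsum => i.
    by rewrite /mid /vsub /vadd /vscale; field.
  rewrite -/(y k) in lk; rewrite -/(y l) in ll.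
  move: lk ll; set A := nrm2 (vsub (y k) x); set C := nrm2 (vsub (y l) x).
  set D := nrm2 _.
  have -> : (/ 2 * A + / 2 * C + - / 4 * D) / (2 * eta) =
    / 2 * (A / (2 * eta)) + / 2 * (C / (2 * eta)) - D / (8 * eta) by field; lra.
  move=> lk ll le.
  have : D / (8 * eta) <= / 2 * (/ (INR k + 1) + / (INR l + 1)) by lra.
  move=> H; have -> : D = D / (8 * eta) * (8 * eta) by field; lra.
  by nra.
have invs e : 0 < e -> exists K, forall k, (K <= k)%coq_nat -> / (INR k + 1) < e.
  move=> e0; have [K [Ke K0]] := archimed_cor1 e e0.
  exists K => k /le_INR kK; apply: Rlt_trans Ke.
  by apply: Rinv_lt_contravar; have := lt_0_INR K K0; nra.
have cauchy i : Cauchy_crit (fun k => y k i).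
  move=> e e0.
  (* Two such terms multiplied by the [4 * eta] of [dist] add up to [e * e]. *)
  have e'0 : 0 < e * e / (8 * eta) by apply: Rdiv_lt_0_compat; nra.
  have [K HK] := invs _ e'0; exists K => k l /HK kK /HK lK.
  apply: (Rsqr_incrst_0 (R_dist (y k i) (y l i))); [|exact: Rabs_pos|lra].
  rewrite /R_dist -Rsqr_abs /Rsqr.
  apply: Rle_lt_trans (sqr_coord_le (vsub (y k) (y l)) i) _.
  apply: Rle_lt_trans (dist k l) _.
  have -> : e * e = 4 * eta * (e * e / (8 * eta) + e * e / (8 * eta)) by field; lra.
  by apply: Rmult_lt_compat_l; lra.
pose p i := proj1_sig (R_complete _ (cauchy i)).
have cvp i : Un_cv (fun k => y k i) (p i) by exact: (proj2_sig (R_complete _ (cauchy i))).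
have cvx := Un_cv_nrm2_sub x cvp.
have := Un_cv_nrm2_sub p cvp; rewrite nrm2_subxx => cv0.
(* Lower semicontinuity is used through real numbers [c] strictly below [h p], which also covers the
   case that [h p] is infinite. *)
have lep c : elt (EFin c) (h p) -> c + nrm2 (vsub p x) / (2 * eta) <= I.
  move=> lt; apply: Rnot_lt_le => gt.
  have [e [e0 He]] := lsch _ _ lt.
  pose gap := c + nrm2 (vsub p x) / (2 * eta) - I.
  have gap0 : 0 < gap by rewrite /gap; lra.
  have gap2 : 0 < gap / 2 by lra.
  have [K1 H1] := invs _ gap2.
  have ee0 : e * e > 0 by nra.
  have [K2 H2] := cv0 _ ee0.
  (* Divided by [2 * eta], this tolerance costs [gap / 2]; the minimizing sequence costs the other
     [gap / 2]. *)
  have eg0 : eta * gap > 0 by nra.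
  have [K3 H3] := cvx _ eg0.
  pose k := (K1 + K2 + K3)%N.
  have k1 : (K1 <= k)%coq_nat by apply/leP; rewrite /k -addnA leq_addr.
  have k2 : (K2 <= k)%coq_nat by apply/leP; rewrite /k -addnA addnCA leq_addr.
  have k3 : (K3 <= k)%coq_nat by apply/leP; rewrite /k leq_addl.
  have {}H1 := H1 _ k1; have {}H2 := H2 _ k2; have {}H3 := H3 _ k3.
  have lte : nrm (vsub (y k) p) < e.
    rewrite -(sqrt_square e); last lra.
    apply: sqrt_lt_1_alt; split; first exact: nrm2_ge0.
    by move: H2; rewrite /R_dist Rminus_0_r Rabs_pos_eq //; exact: nrm2_ge0.
  have := He _ lte; have [-> lk] := yrP k; rewrite /= => ltc.
  move: H3; rewrite /R_dist => /Rabs_def2 [_ H3].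
  rewrite -/(y k) in lk.
  have : (nrm2 (vsub p x) - eta * gap) / (2 * eta) < nrm2 (vsub (y k) x) / (2 * eta).
    by apply: Rmult_lt_compat_r; [apply: Rinv_0_lt_compat|]; lra.
  have -> : (nrm2 (vsub p x) - eta * gap) / (2 * eta) = nrm2 (vsub p x) / (2 * eta) - gap / 2.
    by field; lra.
  have gapE : gap = c + nrm2 (vsub p x) / (2 * eta) - I by [].
  lra.
exists p => z; case Ep : (h p) => [rp|].
  have lerp : rp + nrm2 (vsub p x) / (2 * eta) <= I.
    apply: le_epsilon => e e0.
    have := lep (rp - e); rewrite Ep /= => H.
    have lt : rp - e < rp by lra.
    by have := H lt; lra.
  case Ez : (h z) => [rz|] //=.
  by have := Ile _ _ Ez; lra.
(* An infinite [h p] would admit every [c], in particular one that violates [lep] by 1. *)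
have := lep (I - nrm2 (vsub p x) / (2 * eta) + 1); rewrite Ep /= => H.
by have := H Logic.I; lra.
Qed.

End Prox.

(** * The scalar quantizer and its pointwise error *)

Lemma rsum_bool (F : bool -> R) : rsum F = F true + F false.
Proof. exact: big_bool. Qed.

Lemma rsum_if_card (T : finType) (P : pred T) (c : R) :
  rsum (fun t => if P t then c else 0) = INR #|P| * c.
Proof.
rewrite /rsum -big_mkcond /= big_const; elim: #|P| => [|k IH]; first by rewrite /= Rmult_0_l.
by rewrite iterS IH S_INR; ring.
Qed.

Section Quantizer.
Variables (delta : R) (b : nat).
Hypothesis delta0 : 0 <= delta.

Lemma qfloor_bounds x : delta <> 0 -> qfloor delta x <= x < qfloor delta x + delta.
Proof.
move=> dn0; rewrite /qfloor; have [lo hi] := base_Int_part (x / delta).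
have dp : 0 < delta by lra.
have xE : x = x / delta * delta by field.
by move: (x / delta) xE lo hi => q -> lo hi; split; nra.
Qed.

Lemma qprob_ge0 x bit : 0 <= qprob delta b x bit.
Proof.
rewrite /qprob; case: Req_EM_T => d0 /=; first by case: bit => /=; lra.
case: Rlt_dec => ? /=; first by case: bit => /=; lra.
case: Rlt_dec => ? /=; first by case: bit => /=; lra.
have := qfloor_bounds x d0.
by case: bit => ?; apply: Rmult_le_pos; try lra; apply/Rlt_le/Rinv_0_lt_compat; lra.
Qed.

Lemma qprob_sum1 x : rsum (qprob delta b x) = 1.
Proof.
rewrite rsum_bool /qprob; case: Req_EM_T => d0 /=; first lra.
case: Rlt_dec => ? /=; first lra.
case: Rlt_dec => ? /=; first lra.
by field.
Qed.

Lemma qvprob_ge0 d (x : vec d) bits : 0 <= qvprob delta b x bits.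
Proof. by apply: rprod_ge0 => k; apply: qprob_ge0. Qed.

Lemma qvprob_sum1 d (x : vec d) : rsum (qvprob delta b x) = 1.
Proof.
by apply: (rsum_ffun_rprod1 (w := fun k => qprob delta b (x k))) => k; exact: qprob_sum1.
Qed.

Lemma qlohi : qhi delta b = - qlo delta b - delta.
Proof. by rewrite /qhi /qlo; ring. Qed.

(* The upper bound is not [qhi] because [qval] sends [qhi] to [qhi + delta] on the bit [true],
   although that bit has probability 0. *)
Lemma qval_range x bit :
  qlo delta b <= qhi delta b ->
  qlo delta b - delta <= qval delta b x bit <= qhi delta b + delta.
Proof.
move=> lohi; rewrite /qval; case: Req_EM_T => d0 /=.
  by move: lohi; rewrite qlohi /qlo d0; lra.
case: Rlt_dec => lo /=; first lra.
case: Rlt_dec => hi /=; first lra.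
by have := qfloor_bounds x d0; case: bit; lra.
Qed.

(** Rounding inside the grid moves a point by at most one step, and so does clipping a point at most
    one step outside. The enlarged interval is the one of [qval_range], so the bound applies to
    averages of quantized values. *)
Lemma qval_round_error x bit :
  qlo delta b - delta <= x <= qhi delta b + delta ->
  (qval delta b x bit - x) * (qval delta b x bit - x) <= delta * delta.
Proof.
move=> xr.
suff : - delta <= qval delta b x bit - x <= delta by nra.
rewrite /qval; case: Req_EM_T => d0 /=.
  by move: xr; rewrite qlohi /qlo d0; lra.
case: Rlt_dec => lo /=; first lra.
case: Rlt_dec => hi /=; first lra.
by have := qfloor_bounds x d0; case: bit; lra.
Qed.

Lemma qval_error lam M x bit : 0 < lam <= 1 -> 1 <= 2 ^ b.-1 - 1 ->
  delta = lam * M / (2 ^ b.-1 - 1) -> Rabs x <= M ->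
  (qval delta b x bit - x) * (qval delta b x bit - x) <=
  delta * delta + (if outside delta b x then ((1 - lam) * M) * ((1 - lam) * M) else 0).
Proof.
move=> lam01 K1 dE xM.
(* The top grid point is exactly [lam * M] and the lowest lies one step below [- (lam * M)], so
   clipping a value of size at most [M] moves it by at most [(1 - lam) * M]. *)
have hiE : qhi delta b = lam * M by rewrite /qhi dE; field; lra.
have M0 : 0 <= M by have := Rabs_pos x; lra.
have xb : - M <= x <= M by move: xM; rewrite /Rabs; case: Rcase_abs; lra.
have loE : qlo delta b = - (lam * M) - delta by have := qlohi; lra.
(* With scale 0 the bound [M] vanishes too, so the default output 0 is exact. *)
have zero : delta = 0 -> x = 0.
  move=> d0; have : lam * M = 0 by rewrite -hiE /qhi d0; ring.
  by move/Rmult_integral; lra.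
rewrite /outside; case: Rlt_dec => lo /=.
  rewrite /qval; case: Req_EM_T => d0 /=.
    by rewrite (zero d0); have := Rle_0_sqr ((1 - lam) * M); rewrite /Rsqr; nra.
  case: Rlt_dec => [?|//] /=.
  have : 0 <= qlo delta b - x <= (1 - lam) * M by lra.
  by nra.
case: Rlt_dec => hi /=.
  rewrite /qval; case: Req_EM_T => d0 /=.
    by rewrite (zero d0); have := Rle_0_sqr ((1 - lam) * M); rewrite /Rsqr; nra.
  case: Rlt_dec => [//|?] /=; case: Rlt_dec => [?|//] /=.
  have : 0 <= x - qhi delta b <= (1 - lam) * M by lra.
  by nra.
by rewrite Rplus_0_r; apply: qval_round_error; lra.
Qed.

End Quantizer.

Lemma nrm2_qvec_error d delta b lam M (u : vec d) bits : 0 <= delta ->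
  0 < lam <= 1 -> 1 <= 2 ^ b.-1 - 1 ->
  delta = lam * M / (2 ^ b.-1 - 1) -> (forall k, Rabs (u k) <= M) ->
  nrm2 (vsub (qvec delta b u bits) u) <=
  INR d * (delta * delta) +
  INR #|[pred k | outside delta b (u k)]| * ((1 - lam) * M * ((1 - lam) * M)).
Proof.
move=> d0 lam01 K1 dE uM.
have -> : INR d * (delta * delta) = rsum (fun _ : 'I_d => delta * delta).
  by rewrite rsum_const card_ord.
rewrite -rsum_if_card -rsumD; apply: ler_rsum => k.
exact: qval_error.
Qed.

(** In each coordinate the difference of the two sides is a square divided by [s]. The weight [s]
    stays free because each use balances the two parts differently. *)
Lemma nrm2_triangle d (x y z : vec d) (s : R) : 0 < s ->
  nrm2 (vsub x z) <= (1 + s) * nrm2 (vsub x y) + (1 + / s) * nrm2 (vsub y z).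
Proof.
move=> s0; rewrite /nrm2 /dot -!rsumZ -rsumD; apply: ler_rsum => k; rewrite /vsub.
suff : 0 <= / s * ((s * (x k - y k) - (y k - z k)) * (s * (x k - y k) - (y k - z k))).
  have -> : / s * ((s * (x k - y k) - (y k - z k)) * (s * (x k - y k) - (y k - z k))) =
    (1 + s) * ((x k - y k) * (x k - y k)) + (1 + / s) * ((y k - z k) * (y k - z k))
    - (x k - z k) * (x k - z k) by field; lra.
  lra.
by apply: Rmult_le_pos (Rle_0_sqr _); apply/Rlt_le/Rinv_0_lt_compat.
Qed.

(** The index type is arbitrary so that one notion serves for the workers and for the indices of a
    minibatch. *)
Definition vavg d (T : finType) (u : T -> vec d) : vec d :=
  fun k => / INR #|T| * rsum (fun i => u i k).

(** Convexity of the squared norm, through [sqr_rsum_le] in each coordinate. *)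
Lemma nrm2_vavg_sub d (T : finType) (u v : T -> vec d) (c : R) : (0 < #|T|)%N ->
  (forall i, nrm2 (vsub (u i) (v i)) <= c) -> nrm2 (vsub (vavg u) (vavg v)) <= c.
Proof.
move=> T0 uvc; have TR : 0 < INR #|T| by apply: lt_0_INR; apply/ltP.
have iT : 0 < / INR #|T| by exact: Rinv_0_lt_compat.
apply: (Rle_trans _ (/ INR #|T| * rsum (fun i => nrm2 (vsub (u i) (v i))))).
  rewrite /nrm2 /dot rsum_exchange -rsumZ; apply: ler_rsum => k.
  have -> : vsub (vavg u) (vavg v) k = / INR #|T| * rsum (fun i => u i k - v i k).
    by rewrite rsumB /vavg /vsub; ring.
  have := sqr_rsum_le (fun i => u i k - v i k).
  rewrite /vsub; set a := rsum _; set q := rsum _ => le.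
  have -> : / INR #|T| * a * (/ INR #|T| * a) = / INR #|T| * (/ INR #|T| * (a * a)) by ring.
  apply: Rmult_le_compat_l; first lra.
  have -> : q = / INR #|T| * (INR #|T| * q) by field; lra.
  by apply: Rmult_le_compat_l; lra.
have -> : c = / INR #|T| * rsum (fun _ : T => c) by rewrite rsum_const; field; lra.
by apply: Rmult_le_compat_l; [lra | exact: ler_rsum].
Qed.

(** * The quantization error of one communication round *)

Section Quantization.
Variables (d N b : nat) (lam : R) (sch : scheme).
Hypothesis N0 : (0 < N)%N.
Hypothesis b2 : (2 <= b)%N.
Hypothesis lam01 : 0 < lam <= 1.
Implicit Types u : 'I_N -> vec d.

Lemma pow2_pred_ge1 : 1 <= 2 ^ b.-1 - 1.
Proof.
case: b b2 => [|[|k]] //= _.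
by have := pow_R1_Rle 2 k; lra.
Qed.

Let K1 := pow2_pred_ge1.

Lemma qscale_ge0 (v : vec d) : 0 <= qscale b lam v.
Proof.
rewrite /qscale; apply: Rmult_le_pos; last by apply/Rlt_le/Rinv_0_lt_compat; lra.
by have := ninf_ge0 v; nra.
Qed.

Lemma dmax_ge0 u : 0 <= dmax b lam u.
Proof. exact: bigRmax_ge0. Qed.

Lemma wscale_ge0 u i : 0 <= wscale b lam sch u i.
Proof. by rewrite /wscale; case: sch; auto using dmax_ge0, qscale_ge0. Qed.

Lemma qscale_le (v : vec d) r : ninf v <= r -> qscale b lam v <= lam * r / (2 ^ b.-1 - 1).
Proof.
move=> le; rewrite /qscale; apply: Rmult_le_compat_r; first by apply/Rlt_le/Rinv_0_lt_compat; lra.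
by apply: Rmult_le_compat_l; lra.
Qed.

(** Brings the shared scale into the form required by [qval_error]; [M] is the largest sup norm
    among the workers, recovered from [dmax] by inverting the formula of [qscale]. *)
Lemma dmax_spec u r : 0 <= r -> (forall i, ninf (u i) <= r) ->
  exists M, [/\ 0 <= M <= r, dmax b lam u = lam * M / (2 ^ b.-1 - 1) &
    forall i k, Rabs (u i k) <= M].
Proof.
move=> r0 ur; exists (dmax b lam u * (2 ^ b.-1 - 1) / lam).
have ilam : 0 < / lam by apply: Rinv_0_lt_compat; lra.
have le : dmax b lam u <= lam * r / (2 ^ b.-1 - 1).
  apply: bigRmax_le => [|i]; last exact: qscale_le.
  by apply: Rmult_le_pos; [nra | apply/Rlt_le/Rinv_0_lt_compat; lra].
have mono s t : s <= t -> s * (2 ^ b.-1 - 1) / lam <= t * (2 ^ b.-1 - 1) / lam.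
  by move=> st; apply: Rmult_le_compat_r; [lra | apply: Rmult_le_compat_r; lra].
split; first split.
- by have := mono _ _ (dmax_ge0 u); rewrite Rmult_0_l /Rdiv Rmult_0_l.
- have := mono _ _ le.
  by have -> : lam * r / (2 ^ b.-1 - 1) * (2 ^ b.-1 - 1) / lam = r by field; lra.
- by field; lra.
move=> i k; apply: Rle_trans (Rabs_coord_le_ninf (u i) k) _.
have := mono _ _ (le_bigRmax (fun j => qscale b lam (u j)) i).
rewrite {1}/qscale.
by have -> : lam * ninf (u i) / (2 ^ b.-1 - 1) * (2 ^ b.-1 - 1) / lam = ninf (u i) by field; lra.
Qed.

Lemma wscale_spec u i r : 0 <= r -> (forall i, ninf (u i) <= r) ->
  exists M, [/\ 0 <= M <= r, wscale b lam sch u i = lam * M / (2 ^ b.-1 - 1) &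
    forall k, Rabs (u i k) <= M].
Proof.
move=> r0 ur; have [M [Mr dE uM]] := dmax_spec r0 ur.
rewrite /wscale; case: sch; [|by exists M; split|by exists M; split].
exists (ninf (u i)); split => //; [by split; [exact: ninf_ge0|] | exact: Rabs_coord_le_ninf].
Qed.

(** The bracket of the step size condition without its sampling term. *)
Definition quant_const (dlam : R) : R :=
  match sch with
  | SchC => 3 * INR d * lam ^ 2 / (8 * (2 ^ b.-1 - 1) ^ 2) + dlam * (1 - lam) ^ 2
  | _ => INR d * lam ^ 2 / (4 * (2 ^ b.-1 - 1) ^ 2) + dlam * (1 - lam) ^ 2
  end.

Lemma avgqE u bits : avgq b lam sch u bits =
  vavg (fun i => qvec (wscale b lam sch u i) b (u i) (bits i)).
Proof. by rewrite /avgq /vavg card_ord. Qed.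

(** Convexity reduces the average to a single worker. The pointwise rounding term has coefficient 1
    where [quant_const] has 1/4 or 3/8; the factor 32/3 of [utilde_error] makes up for this. *)
Lemma avgq_error dlam u bits r : 0 <= dlam -> 0 <= r -> (forall i, ninf (u i) <= r) ->
  (forall i, INR #|[pred k | outside (wscale b lam sch u i) b (u i k)]| <= dlam) ->
  nrm2 (vsub (avgq b lam sch u bits) (vavg u)) <=
  (INR d * lam ^ 2 / (2 ^ b.-1 - 1) ^ 2 + dlam * (1 - lam) ^ 2) * (r * r).
Proof.
move=> dl0 r0 ur out; rewrite avgqE; apply: nrm2_vavg_sub; first by rewrite card_ord.
move=> i; have [M [[M0 Mr] wE uM]] := wscale_spec i r0 ur.
apply: Rle_trans (nrm2_qvec_error (bits i) (wscale_ge0 u i) lam01 K1 wE uM) _.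
have MM : M * M <= r * r by nra.
rewrite Rmult_plus_distr_r; apply: Rplus_le_compat.
  rewrite wE.
  have -> : INR d * (lam * M / (2 ^ b.-1 - 1) * (lam * M / (2 ^ b.-1 - 1))) =
    INR d * lam ^ 2 / (2 ^ b.-1 - 1) ^ 2 * (M * M) by field; lra.
  apply: Rmult_le_compat_l => //; apply: Rmult_le_pos.
    by apply: Rmult_le_pos; [exact: pos_INR | nra].
  by apply/Rlt_le/Rinv_0_lt_compat; nra.
have -> : (1 - lam) * M * ((1 - lam) * M) = (1 - lam) ^ 2 * (M * M) by ring.
rewrite Rmult_assoc; apply: Rmult_le_compat => //; [exact: pos_INR | |].
  by apply: Rmult_le_pos; nra.
by apply: Rmult_le_compat_l => //; nra.
Qed.

Lemma qlo_le_qhi delta : 0 <= delta -> qlo delta b <= qhi delta b.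
Proof. by rewrite /qlo /qhi; nra. Qed.

(** In scheme (c) all workers share one grid, and an average stays in an interval that contains all
    its terms. Hence the second quantization adds no clipping term. *)
Lemma avgq_range u bits k : sch = SchC ->
  qlo (dmax b lam u) b - dmax b lam u <= avgq b lam sch u bits k <=
  qhi (dmax b lam u) b + dmax b lam u.
Proof.
move=> schC; have NR : 0 < INR N by apply: lt_0_INR; apply/ltP.
have iN : 0 < / INR N by exact: Rinv_0_lt_compat.
have cst c : c = / INR N * rsum (fun _ : 'I_N => c) by rewrite rsum_const card_ord; field; lra.
have rng i := @qval_range (dmax b lam u) b (dmax_ge0 u) (u i k) (bits i k)
  (qlo_le_qhi (dmax_ge0 u)).
rewrite /avgq /wscale schC; split.
  rewrite [X in X <= _]cst; apply: Rmult_le_compat_l; first lra.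
  by apply: ler_rsum => i; have := rng i; rewrite /qvec; lra.
rewrite [X in _ <= X]cst; apply: Rmult_le_compat_l; first lra.
by apply: ler_rsum => i; have := rng i; rewrite /qvec; lra.
Qed.

(* The rounding error is bounded pointwise by one grid step, without using that the rounding is
   unbiased: the constant 8 of the step size condition leaves just enough room for this. *)
Lemma utilde_error dlam u bits bits2 r : 0 <= dlam -> 0 <= r -> (forall i, ninf (u i) <= r) ->
  (forall i, INR #|[pred k | outside (wscale b lam sch u i) b (u i k)]| <= dlam) ->
  nrm2 (vsub (utilde b lam sch u bits bits2) (vavg u)) <= 32 / 3 * quant_const dlam * (r * r).
Proof.
move=> dl0 r0 ur out.
have e1 := avgq_error bits dl0 r0 ur out.
set A := INR d * lam ^ 2 / (2 ^ b.-1 - 1) ^ 2 in e1.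
set D := dlam * (1 - lam) ^ 2 in e1.
have rr : 0 <= r * r by nra.
have A0 : 0 <= A.
  apply: Rmult_le_pos; first by apply: Rmult_le_pos; [exact: pos_INR | nra].
  by apply/Rlt_le/Rinv_0_lt_compat; nra.
have D0 : 0 <= D by apply: Rmult_le_pos => //; nra.
have qc : quant_const dlam = match sch with SchC => 3 / 8 * A + D | _ => / 4 * A + D end.
  by rewrite /quant_const /A /D; case: sch; field; lra.
have ab : nrm2 (vsub (avgq b lam sch u bits) (vavg u)) <= 32 / 3 * (/ 4 * A + D) * (r * r).
  apply: Rle_trans e1 _; apply: Rmult_le_compat_r => //; lra.
move: ab e1 qc; rewrite /utilde; case E : sch => ab e1 ->; [exact: ab|exact: ab|].
have one : 0 < 1 by lra.
apply: Rle_trans (nrm2_triangle _ (avgq b lam SchC u bits) _ one) _.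
have e2 : nrm2 (vsub (qvec (dmax b lam u) b (avgq b lam SchC u bits) bits2)
    (avgq b lam SchC u bits)) <= A * (r * r).
  have [M [[M0 Mr] dE _]] := dmax_spec r0 ur.
  apply: (Rle_trans _ (rsum (fun _ : 'I_d => dmax b lam u * dmax b lam u))).
    apply: ler_rsum => k; rewrite /vsub /qvec; apply: qval_round_error; first exact: dmax_ge0.
    by rewrite -E; apply: avgq_range.
  rewrite rsum_const card_ord dE.
  have -> : INR d * (lam * M / (2 ^ b.-1 - 1) * (lam * M / (2 ^ b.-1 - 1))) = A * (M * M).
    by rewrite /A; field; lra.
  by apply: Rmult_le_compat_l => //; nra.
rewrite Rinv_1.
(* The total is [4 * A + 2 * D]. The constant 32/3 is fixed here: 32/3 times 3/8 is exactly 4. *)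
apply: (Rle_trans _ ((1 + 1) * (A * (r * r)) + (1 + 1) * ((A + D) * (r * r)))); first lra.
have : 0 <= D * (r * r) by nra.
by lra.
Qed.

Lemma qweight_ge0 u bits bits2 : 0 <= qweight b lam sch u bits bits2.
Proof.
apply: Rmult_le_pos.
  by apply: rprod_ge0 => i; apply: qvprob_ge0; exact: wscale_ge0.
have bits2_ge0 : 0 <= rprod (fun k : 'I_d => if bits2 k then 0 else 1).
  by apply: rprod_ge0 => k; case: (bits2 k); lra.
by case: sch => //; apply: qvprob_ge0; exact: dmax_ge0.
Qed.

(** The sum over [bits2] is taken first, since in scheme (c) the law of the second rounding depends
    on [bits]. *)
Lemma qweight_sum1 u :
  rsum (fun bits => rsum (fun bits2 => qweight b lam sch u bits bits2)) = 1.
Proof.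
rewrite -(rsum_ffun_rprod1 (w := fun i => qvprob (wscale b lam sch u i) b (u i))); last first.
  by move=> i; apply: qvprob_sum1.
apply: eq_rsum => bits; rewrite /qweight rsumZ -[RHS]Rmult_1_r; congr (_ * _).
have bits2_sum1 : rsum (fun bits2 : {ffun 'I_d -> bool} =>
    rprod (fun k : 'I_d => if bits2 k then 0 else 1)) = 1.
  apply: (rsum_ffun_rprod1 (w := fun _ bit => if bit then 0 else 1)) => k.
  by rewrite rsum_bool; lra.
by case: sch => //; apply: qvprob_sum1.
Qed.

End Quantization.

(** * The variance of minibatch sampling *)

Section Sampling.
Variables (d n N B : nat) (g : 'I_n -> vec d -> vec d).
Hypothesis n0 : (0 < n)%N.
Hypothesis N0 : (0 < N)%N.
Hypothesis B0 : (0 < B)%N.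

Let nR : 0 < INR n. Proof. by apply: lt_0_INR; apply/ltP. Qed.
Let NR : 0 < INR N. Proof. by apply: lt_0_INR; apply/ltP. Qed.
Let BR : 0 < INR B. Proof. by apply: lt_0_INR; apply/ltP. Qed.

(** Exhibits the uniform weight as a nested product, over workers and then over draws, as the
    independence lemmas expect. *)
Lemma sample_weightE (I : {ffun 'I_N -> {ffun 'I_B -> 'I_n}}) :
  (/ INR n) ^ (N * B) =
  rprod (fun i : 'I_N => rprod (fun a : 'I_B => (fun _ => / INR n) (I i a))).
Proof. by rewrite !rprod_const !card_ord -pow_mult mulnC. Qed.

Let w1 : rsum (fun _ : 'I_n => / INR n) = 1.
Proof. by rewrite rsum_const card_ord; field; lra. Qed.

Lemma sample_weight_sum1 :
  rsum (fun _ : {ffun 'I_N -> {ffun 'I_B -> 'I_n}} => (/ INR n) ^ (N * B)) = 1.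
Proof.
rewrite (eq_rsum sample_weightE).
apply: (rsum_ffun_rprod1 (w := fun (_ : 'I_N) (J : {ffun 'I_B -> 'I_n}) =>
  rprod (fun a : 'I_B => (fun _ => / INR n) (J a)))) => i.
exact: (rsum_ffun_rprod1 (w := fun (_ : 'I_B) (_ : 'I_n) => / INR n)).
Qed.

(** The variance formula is applied twice: across workers, with a whole minibatch as one draw, and
    then inside a minibatch. *)
Lemma sample_variance_coord (X : 'I_n -> R) :
  rsum X = 0 ->
  rsum (fun I : {ffun 'I_N -> {ffun 'I_B -> 'I_n}} => (/ INR n) ^ (N * B) *
    (rsum (fun i => rsum (fun a => X (I i a))) * rsum (fun i => rsum (fun a => X (I i a))))) =
  INR N * (INR B * (/ INR n * rsum (fun t => X t * X t))).
Proof.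
move=> X0.
have wX : rsum (fun t => / INR n * X t) = 0 by rewrite rsumZ X0 Rmult_0_r.
pose W (J : {ffun 'I_B -> 'I_n}) := rprod (fun a : 'I_B => (fun _ => / INR n) (J a)).
pose Y (J : {ffun 'I_B -> 'I_n}) := rsum (fun a => X (J a)).
have W1 : rsum W = 1 by exact: (rsum_ffun_rprod1 (w := fun (_ : 'I_B) (_ : 'I_n) => / INR n)).
have WY : rsum (fun J => W J * Y J) = 0.
  exact: (@rsum_ffun_rprod_centred _ _ (fun _ => / INR n) X).
have := @rsum_ffun_variance 'I_N _ W Y W1 WY; rewrite card_ord.
have -> : rsum (fun J => W J * (Y J * Y J)) = INR B * (/ INR n * rsum (fun t => X t * X t)).
  rewrite -rsumZ -[INR B](congr1 INR (card_ord B)).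
  exact: (@rsum_ffun_variance 'I_B _ (fun _ => / INR n) X w1 wX).
by move=> <-; apply: eq_rsum => I; rewrite (sample_weightE I).
Qed.

(** Coordinatewise, the average of [N * B] independent draws has variance 1/(NB) times that of one
    draw; the latter is at most the second moment, which the Lipschitz condition bounds after
    summation over the coordinates. *)
Lemma sample_variance (L : R) (xt x : vec d) :
  (forall a x y, nrm (vsub (g a x) (g a y)) <= L * nrm (vsub x y)) ->
  rsum (fun I : {ffun 'I_N -> {ffun 'I_B -> 'I_n}} => (/ INR n) ^ (N * B) *
    nrm2 (vsub (vavg (fun i => uvec g xt x (I i))) (vsub (gavg g x) (gavg g xt)))) <=
  1 / (INR N * INR B) * (L ^ 2 * nrm2 (vsub x xt)).
Proof.
move=> gL.
pose mu k := / INR n * rsum (fun t => g t x k - g t xt k).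
pose X k t := g t x k - g t xt k - mu k.
have X0 k : rsum (X k) = 0.
  by rewrite /X rsumB rsum_const card_ord /mu; field; lra.
have coordE (I : {ffun 'I_N -> {ffun 'I_B -> 'I_n}}) k :
    vsub (vavg (fun i => uvec g xt x (I i))) (vsub (gavg g x) (gavg g xt)) k =
    / (INR N * INR B) * rsum (fun i => rsum (fun a => X k (I i a))).
  rewrite /vsub /vavg /uvec /gavg card_ord.
  have -> : / INR n * rsum (fun a => g a x k) - / INR n * rsum (fun a => g a xt k) = mu k.
    by rewrite /mu rsumB; ring.
  rewrite [in RHS](eq_rsum (G := fun i =>
    rsum (fun a => g (I i a) x k - g (I i a) xt k) - INR B * mu k)).
    by rewrite rsumB rsumZ rsum_const card_ord; set s := rsum _; field; lra.
  by move=> i; rewrite /X rsumB rsum_const card_ord.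
apply: (Rle_trans _ (rsum (fun k : 'I_d => 1 / (INR N * INR B) *
    (/ INR n * rsum (fun t => (g t x k - g t xt k) * (g t x k - g t xt k)))))).
  rewrite (eq_rsum (G := fun I : {ffun 'I_N -> {ffun 'I_B -> 'I_n}} => rsum (fun k =>
    / (INR N * INR B) * / (INR N * INR B) * ((/ INR n) ^ (N * B) *
    (rsum (fun i => rsum (fun a => X k (I i a))) * rsum (fun i => rsum (fun a => X k (I i a)))))))).
    rewrite rsum_exchange; apply: ler_rsum => k.
    rewrite rsumZ sample_variance_coord //.
    have -> : / (INR N * INR B) * / (INR N * INR B) *
      (INR N * (INR B * (/ INR n * rsum (fun t => X k t * X k t)))) =
      1 / (INR N * INR B) * (/ INR n * rsum (fun t => X k t * X k t)) by field; lra.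
    apply: Rmult_le_compat_l.
      by apply: Rmult_le_pos; [lra | apply/Rlt_le/Rinv_0_lt_compat; nra].
    apply: Rmult_le_compat_l; first exact/Rlt_le/Rinv_0_lt_compat.
    (* Variance is second moment minus squared mean. *)
    have -> : rsum (fun t => X k t * X k t) =
        rsum (fun t => (g t x k - g t xt k) * (g t x k - g t xt k)) - INR n * (mu k * mu k).
      have -> : INR n * (mu k * mu k) =
          rsum (fun t => 2 * mu k * (g t x k - g t xt k) - mu k * mu k).
        rewrite rsumB rsumZ rsum_const card_ord.
        have -> : rsum (fun t => g t x k - g t xt k) = INR n * mu k by rewrite /mu; field; lra.
        by ring.
      by rewrite -rsumB; apply: eq_rsum => t; rewrite /X; ring.
    have : 0 <= mu k * mu k by exact: Rle_0_sqr.
    by nra.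
  move=> I; rewrite /nrm2 /dot -rsumZ; apply: eq_rsum => k.
  by rewrite coordE; ring.
rewrite rsumZ; apply: Rmult_le_compat_l.
  by apply: Rmult_le_pos; [lra | apply/Rlt_le/Rinv_0_lt_compat; nra].
rewrite rsumZ rsum_exchange.
have -> : L ^ 2 * nrm2 (vsub x xt) = / INR n * rsum (fun _ : 'I_n => L ^ 2 * nrm2 (vsub x xt)).
  by rewrite rsum_const card_ord; field; lra.
apply: Rmult_le_compat_l; first exact/Rlt_le/Rinv_0_lt_compat.
apply: ler_rsum => t.
apply: Rle_trans (nrm2_le_sqr (gL t x xt)) _.
by rewrite -[nrm2 (vsub x xt)]nrm_sqr; lra.
Qed.

Lemma nrm_uvec_le (L : R) (xt x : vec d) (J : {ffun 'I_B -> 'I_n}) : 0 <= L ->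
  (forall a x y, nrm (vsub (g a x) (g a y)) <= L * nrm (vsub x y)) ->
  nrm (uvec g xt x J) <= L * nrm (vsub x xt).
Proof.
move=> L0 gL.
apply: nrm_le_of_sqr; first by have := nrm_ge0 (vsub x xt); nra.
have -> : uvec g xt x J = vsub (vavg (fun a => g (J a) x)) (vavg (fun a => g (J a) xt)).
  by apply: functional_extensionality => k; rewrite /uvec /vsub /vavg card_ord rsumB; ring.
apply: nrm2_vavg_sub => [|a]; first by rewrite card_ord.
exact: nrm2_le_sqr.
Qed.

End Sampling.

(** * Descent of one inexact proximal step *)

Lemma prox_step_descent d (h : vec d -> ereal) (eta L : R) (x v G xp xb : vec d)
  (fx fp hx hp hb : R) :
  0 < eta -> convex_fun h ->
  is_prox h eta (vsub x (vscale eta v)) xp -> is_prox h eta (vsub x (vscale eta G)) xb ->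
  h x = EFin hx -> h xp = EFin hp -> h xb = EFin hb ->
  fp <= fx + dot G (vsub xp x) + L / 2 * nrm2 (vsub xp x) ->
  fp + hp <= fx + hx + eta / 2 * nrm2 (vsub v G) - / (2 * eta) * nrm2 (vsub x xb)
    - (/ (2 * eta) - L / 2) * nrm2 (vsub xp x).
Proof.
move=> eta0 convh Pp Pb Ex Ep Eb fle.
(* Optimality of [xp] is tested at [xb] and that of [xb] at [x], so [hb] cancels in the sum. *)
have i1 := prox_variational eta0 convh Pp Ep Eb.
have i2 := prox_variational eta0 convh Pb Eb Ex.
have := Young (vsub G v) (vsub xp xb) eta0; rewrite (nrm2_subC G v) => yg.
(* Polarization of both inner products. The last term, in [vsub xp xb], cancels the one that Young's
   inequality [yg] produces. *)
have E : / eta * dot (vsub (vsub x (vscale eta v)) xp) (vsub xp xb) +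
    / eta * dot (vsub (vsub x (vscale eta G)) xb) (vsub xb x) + dot G (vsub xp x) =
    dot (vsub G v) (vsub xp xb) - / (2 * eta) * nrm2 (vsub x xb)
    - / (2 * eta) * nrm2 (vsub xp x) - / (2 * eta) * nrm2 (vsub xp xb).
  rewrite /nrm2 /dot -!rsumZ -!rsumD -!rsumB; apply: eq_rsum => k.
  by rewrite /vsub /vscale; field; lra.
move: i1 i2; rewrite /Rdiv !(Rmult_comm _ (/ eta)) => i1 i2; lra.
Qed.

(** * Expected descent, the potential of an epoch, and telescoping *)

Section Convergence.
Variables (d n N Sep m B b : nat).
Hypotheses (n0 : (0 < n)%N) (N0 : (0 < N)%N) (m0 : (0 < m)%N) (B0 : (0 < B)%N) (b2 : (2 <= b)%N).
Variables (f : 'I_n -> vec d -> R) (g : 'I_n -> vec d -> vec d) (L : R).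
Hypothesis fg : forall a, has_gradient (f a) (g a).
Hypothesis L0 : 0 < L.
Hypothesis gL : forall a x y, nrm (vsub (g a x) (g a y)) <= L * nrm (vsub x y).
Variable h : vec d -> ereal.
Hypotheses (proph : proper_fun h) (convh : convex_fun h) (lsch : lsc_fun h).
Variable pstar : R.
Hypothesis pstarP : forall y r, h y = EFin r -> pstar <= favg f y + r.
Variables (rho lam : R) (sch : scheme) (x0 : vec d) (dlam : R).
Hypotheses (rho0 : 0 < rho < 1 / 2) (lam01 : 0 < lam <= 1) (dlam0 : 0 <= dlam).
Let eta := rho / L.
Let Gamma := quant_const d b lam sch dlam + 1 / (INR N * INR B).
Hypothesis dlamP : forall (j : nat) (st : vec d * vec d), (j < Sep * m)%N ->
  reach N B m b g h eta lam sch x0 j st ->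
  forall (I : {ffun 'I_N -> {ffun 'I_B -> 'I_n}}) (i : 'I_N),
  INR (n_outside b g lam sch st I i) <= dlam.
Hypothesis cond : 8 * INR m ^ 2 * rho ^ 2 * Gamma + rho <= 1.

Lemma eta_gt0 : 0 < eta.
Proof. by apply: Rdiv_lt_0_compat; lra. Qed.
Let eta0 := eta_gt0.

(** Existence needs a lower bound: [h] is at least [pstar] minus the smooth part, which by the
    descent lemma and Young's inequality grows at most like [L] times the squared distance to [x].
    As [rho < 1/2], the proximal term dominates this. *)
Lemma prox_is_prox x : is_prox h eta x (prox h eta x).
Proof.
apply: epsilon_spec; apply: prox_exists => //.
exists (pstar - favg f x - nrm2 (gavg g x) / (2 * L)) => y r hy.
have le1 := pstarP hy.
have le2 := descent_lemma_avg n0 fg gL x y.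
have iL : 0 < / L by exact: Rinv_0_lt_compat.
have le3 := Young (gavg g x) (vsub y x) iL.
have Q0 := nrm2_ge0 (vsub y x).
move: le2 le3 Q0; set Q := nrm2 (vsub y x); set G := nrm2 _ => le2 le3 Q0.
have e1 : / L / 2 * G = G / (2 * L) by field; lra.
have e2 : / (2 * / L) * Q = L / 2 * Q by field; lra.
have le4 : L * Q <= Q / (2 * eta).
  have -> : Q / (2 * eta) = L * Q * / (2 * rho) by rewrite /eta; field; lra.
  rewrite -[X in X <= _]Rmult_1_r; apply: Rmult_le_compat_l; first nra.
  by rewrite -Rinv_1; apply: Rinv_le_contravar; lra.
lra.
Qed.

Lemma prox_finite x : exists r, h (prox h eta x) = EFin r.
Proof. exact: is_prox_finite (prox_is_prox x). Qed.

(** The value 0 at [EPInf] is a placeholder: [P] is estimated only at points where [h] is finite,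
    namely the starting point and proximal points. *)
Let hval x := match h x with EFin r => r | EPInf => 0 end.
Let P x := favg f x + hval x.
Let Gsq (st : vec d * vec d) := nrm2 (gmap g h eta st.2).

(** All randomness of one iteration in one type, which turns the triple sum of [Eval] into a single
    one. *)
Let Omega : finType :=
  ({ffun 'I_N -> {ffun 'I_B -> 'I_n}} * {ffun 'I_N -> {ffun 'I_d -> bool}}
   * {ffun 'I_d -> bool})%type.
Let wt st (w : Omega) := weight b g lam sch st w.1.1 w.1.2 w.2.
Let nxt j st (w : Omega) := step m b g h eta lam sch j st w.1.1 w.1.2 w.2.
Let vdir st (w : Omega) :=
  vadd (utilde b lam sch (ustate g st w.1.1) w.1.2 w.2) (gavg g st.1).

Lemma EvalS k j F st : Eval N B m b g h eta lam sch k.+1 j F st =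
  rsum (fun w : Omega => wt st w * Eval N B m b g h eta lam sch k j.+1 F (nxt j st w)).
Proof.
rewrite /= (rsum_pair (fun I bits => rsum (fun bits2 => _))).
by rewrite (rsum_pair (fun Ib bits2 => _)).
Qed.

Lemma wt_ge0 st w : 0 <= wt st w.
Proof.
apply: Rmult_le_pos; last exact: qweight_ge0.
by apply/pow_le/Rlt_le/Rinv_0_lt_compat/lt_0_INR/ltP.
Qed.

(** For a quantity that depends on the samples alone the rounding bits sum out, since their weights
    given [I] add up to 1. *)
Lemma wt_marginal st (F : {ffun 'I_N -> {ffun 'I_B -> 'I_n}} -> R) :
  rsum (fun w => wt st w * F w.1.1) = rsum (fun I => (/ INR n) ^ (N * B) * F I).
Proof.
rewrite -(rsum_pair (fun Ib bits2 => weight b g lam sch st Ib.1 Ib.2 bits2 * F Ib.1)).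
rewrite -(rsum_pair (fun I bits => rsum (fun bits2 => weight b g lam sch st I bits bits2 * F I))).
apply: eq_rsum => I; rewrite -[RHS]Rmult_1_r.
rewrite -(qweight_sum1 (d := d) (N := N) b lam sch (ustate g st I)).
rewrite -rsumZ; apply: eq_rsum => bits; rewrite -rsumZ; apply: eq_rsum => bits2.
by rewrite /weight; ring.
Qed.

Lemma wt_sum1 st : rsum (wt st) = 1.
Proof.
rewrite -(sample_weight_sum1 N B n0) -[RHS](eq_rsum (F := fun I => (/ INR n) ^ (N * B) * 1)).
  by rewrite -(wt_marginal st (fun _ => 1)); apply: eq_rsum => w; ring.
by move=> I; ring.
Qed.

Lemma vdir_error j st w : (j < Sep * m)%N -> reach N B m b g h eta lam sch x0 j st ->
  nrm2 (vsub (vdir st w) (gavg g st.2)) <=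
  16 * quant_const d b lam sch dlam * (L ^ 2 * nrm2 (vsub st.2 st.1)) +
  3 * nrm2 (vsub (vavg (fun i => uvec g st.1 st.2 (w.1.1 i)))
                 (vsub (gavg g st.2) (gavg g st.1))).
Proof.
move=> jT rst.
set mu := vsub (gavg g st.2) _; set u := vavg _.
have -> : nrm2 (vsub (vdir st w) (gavg g st.2)) =
    nrm2 (vsub (utilde b lam sch (ustate g st w.1.1) w.1.2 w.2) mu).
  by apply: eq_rsum => k; rewrite /vdir /mu /vsub /vadd; ring.
(* With [s = 1/2] the quantization error gets the factor 3/2, where 3/2 times 32/3 is 16, and the
   sampling error gets the factor 3. *)
have half : 0 < / 2 by lra.
apply: Rle_trans (nrm2_triangle _ u _ half) _.
have r0 : 0 <= L * nrm (vsub st.2 st.1) by have := nrm_ge0 (vsub st.2 st.1); nra.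
have ur i : ninf (ustate g st w.1.1 i) <= L * nrm (vsub st.2 st.1).
  apply: Rle_trans (ninf_le_nrm _) _; apply: nrm_uvec_le => //; lra.
have out := dlamP jT rst w.1.1.
have := utilde_error N0 b2 lam01 w.1.2 w.2 dlam0 r0 ur out.
have -> : L * nrm (vsub st.2 st.1) * (L * nrm (vsub st.2 st.1)) = L ^ 2 * nrm2 (vsub st.2 st.1).
  by rewrite -nrm_sqr; ring.
rewrite -/u; lra.
Qed.

Lemma expected_error j st : (j < Sep * m)%N -> reach N B m b g h eta lam sch x0 j st ->
  rsum (fun w => wt st w * nrm2 (vsub (vdir st w) (gavg g st.2))) <=
  16 * Gamma * (L ^ 2 * nrm2 (vsub st.2 st.1)).
Proof.
move=> jT rst.
set c := 16 * quant_const d b lam sch dlam * (L ^ 2 * nrm2 (vsub st.2 st.1)).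
pose s (I : {ffun 'I_N -> {ffun 'I_B -> 'I_n}}) :=
  nrm2 (vsub (vavg (fun i => uvec g st.1 st.2 (I i))) (vsub (gavg g st.2) (gavg g st.1))).
apply: (Rle_trans _ (rsum (fun w => wt st w * c + 3 * (wt st w * s w.1.1)))).
  apply: ler_rsum => w; have := Rmult_le_compat_l _ _ _ (wt_ge0 st w) (vdir_error w jT rst).
  by rewrite -/c -/(s w.1.1); lra.
rewrite rsumD rsumZr wt_sum1 rsumZ (wt_marginal st s).
set V := rsum _.
have : V <= 1 / (INR N * INR B) * (L ^ 2 * nrm2 (vsub st.2 st.1)) by exact: sample_variance.
(* Nonnegativity allows the factor 3 of the sampling term to be raised to the common 16. *)
have : 0 <= 1 / (INR N * INR B) * (L ^ 2 * nrm2 (vsub st.2 st.1)).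
  apply: Rmult_le_pos.
    apply: Rmult_le_pos; first lra.
    by apply/Rlt_le/Rinv_0_lt_compat/Rmult_lt_0_compat; apply/lt_0_INR/ltP.
  by apply: Rmult_le_pos; [nra | exact: nrm2_ge0].
rewrite /Gamma /c; lra.
Qed.

Lemma step_descent j st w hx : h st.2 = EFin hx ->
  P (nxt j st w).2 <= P st.2 + eta / 2 * nrm2 (vsub (vdir st w) (gavg g st.2))
    - eta / 2 * Gsq st - (1 - rho) / (2 * eta) * nrm2 (vsub (nxt j st w).2 st.2).
Proof.
move=> Ex.
have nE : (nxt j st w).2 = prox h eta (vsub st.2 (vscale eta (vdir st w))).
  by rewrite /nxt /step /vdir; case: ifP.
have [hp Ep] := prox_finite (vsub st.2 (vscale eta (vdir st w))).
have [hb Eb] := prox_finite (vsub st.2 (vscale eta (gavg g st.2))).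
have := prox_step_descent eta0 convh (prox_is_prox _) (prox_is_prox _) Ex Ep Eb
  (descent_lemma_avg n0 fg gL st.2 _).
rewrite nE /P /hval Ex Ep.
have -> : eta / 2 * Gsq st = / (2 * eta) *
    nrm2 (vsub st.2 (prox h eta (vsub st.2 (vscale eta (gavg g st.2))))).
  rewrite /Gsq /gmap /nrm2 /dot -!rsumZ; apply: eq_rsum => k.
  by rewrite /vscale /vsub; field; lra.
have -> : (1 - rho) / (2 * eta) = / (2 * eta) - L / 2 by rewrite /eta; field; lra.
lra.
Qed.

(** The expected cost of the error in one step per unit of squared distance to the snapshot:
    [eta / 2] times [16 * Gamma * L ^ 2]. *)
Let a := 8 * eta * L ^ 2 * Gamma.
(* [pot t * w] pays for the remaining variance of an epoch, where [w] is the sum of the squared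
   step lengths so far. *)
Let pot (t : nat) := a / 2 * (INR m ^ 2 - INR t ^ 2).

Lemma Gamma_ge0 : 0 <= Gamma.
Proof.
have A0 c : 0 < c -> 0 <= INR d * lam ^ 2 / (c * (2 ^ b.-1 - 1) ^ 2).
  move=> c0; have K1 := pow2_pred_ge1 b2.
  apply: Rmult_le_pos; first by apply: Rmult_le_pos; [exact: pos_INR | nra].
  by apply/Rlt_le/Rinv_0_lt_compat/Rmult_lt_0_compat => //; nra.
have D0 : 0 <= dlam * (1 - lam) ^ 2 by apply: Rmult_le_pos => //; nra.
apply: Rplus_le_le_0_compat; last first.
  apply: Rmult_le_pos; first lra.
  by apply/Rlt_le/Rinv_0_lt_compat/Rmult_lt_0_compat; apply/lt_0_INR/ltP.
have p4 : 0 < 4 by lra. have p8 : 0 < 8 by lra.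
have := A0 _ p4; have := A0 _ p8.
by rewrite /quant_const; case: sch; rewrite ?[3 * INR d * _]Rmult_assoc /Rdiv ?[3 * _ * _]Rmult_assoc;
  lra.
Qed.

Lemma a_ge0 : 0 <= a.
Proof.
have := Gamma_ge0 => G0; apply: Rmult_le_pos => //; apply: Rmult_le_pos; nra.
Qed.

(** The step size condition enters here: after multiplication by [2 * eta], the bound
    [a / 2 * INR m ^ 2] becomes [8 * INR m ^ 2 * rho ^ 2 * Gamma]. *)
Lemma pot_le t : pot t <= (1 - rho) / (2 * eta).
Proof.
have p : 0 <= INR t ^ 2 by nra.
apply: (Rle_trans _ (a / 2 * INR m ^ 2)).
  by rewrite /pot; have := a_ge0; nra.
have -> : a / 2 * INR m ^ 2 = 8 * INR m ^ 2 * rho ^ 2 * Gamma / (2 * eta).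
  by rewrite /a /eta; field; lra.
by apply: Rmult_le_compat_r; [apply/Rlt_le/Rinv_0_lt_compat|]; lra.
Qed.

(** The potential drops by [a * (INR t + 1 / 2)], which pays for the error at step [t]. *)
Lemma pot_step t : pot t.+1 + a * INR t <= pot t.
Proof. by rewrite /pot S_INR; have := a_ge0; nra. Qed.

(** The triangle inequality with weight [s = t] turns the factor [t] into [t + 1]. For [t = 0] there
    is nothing to divide by, but then the hypothesis forces [x = xt]. *)
Lemma nrm2_sub_extend (x xt y : vec d) (t : nat) (w : R) :
  nrm2 (vsub x xt) <= INR t * w -> 0 <= w ->
  nrm2 (vsub y xt) <= INR t.+1 * (w + nrm2 (vsub y x)).
Proof.
case: t => [|t] le w0.
  have z : nrm2 (vsub x xt) = 0 by have := nrm2_ge0 (vsub x xt); move: le; rewrite /= ; lra.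
  have xE : x = xt.
    apply: functional_extensionality => k.
    by have := sqr_coord_le (vsub x xt) k; rewrite z /vsub; nra.
  by rewrite xE /=; lra.
have tp : 0 < INR t.+1 by exact/lt_0_INR/ltP.
apply: Rle_trans (nrm2_triangle y x xt tp) _.
rewrite (S_INR t.+1).
have : (1 + / INR t.+1) * nrm2 (vsub x xt) <= (1 + / INR t.+1) * (INR t.+1 * w).
  apply: Rmult_le_compat_l => //.
  by have := Rinv_0_lt_compat _ tp; lra.
have -> : (1 + / INR t.+1) * (INR t.+1 * w) = (INR t.+1 + 1) * w by field; lra.
lra.
Qed.

(** Induction on the number [K] of remaining steps, from an arbitrary reachable state. Generalizing
    over [w], a budget for the squared step lengths since the snapshot, lets the induction start in
    the middle of an epoch. *)
Lemma Gsq_sum_bound K : forall j st w, (j + K <= Sep * m)%N ->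
  reach N B m b g h eta lam sch x0 j st -> (exists r, h st.2 = EFin r) -> 0 <= w ->
  nrm2 (vsub st.2 st.1) <= INR (j %% m) * w ->
  eta / 2 * rsum (fun k : 'I_K => Eval N B m b g h eta lam sch k j Gsq st) <=
  P st.2 - pstar + pot (j %% m) * w.
Proof.
elim: K => [|K IH] j st w jK rst [hx Ex] w0 dist.
  rewrite /rsum big_ord0 Rmult_0_r.
  have pot0 : 0 <= pot (j %% m).
    have /ltP/lt_INR tm := ltn_pmod j m0.
    by apply: Rmult_le_pos; [have := a_ge0; lra | have := pos_INR (j %% m); nra].
  have := pstarP Ex; rewrite /P /hval Ex; nra.
have jT : (j < Sep * m)%N by apply: leq_trans jK; rewrite addnS ltnS leq_addr.
set t := (j %% m)%N in dist *.
pose W (om : Omega) := nrm2 (vsub (nxt j st om).2 st.2).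
have nfin om : exists r, h (nxt j st om).2 = EFin r.
  by rewrite /nxt /step; case: ifP => _; apply: prox_finite.
(* The induction hypothesis needs a reachable successor, hence a positive weight. *)
have next om : 0 < wt st om ->
    eta / 2 * rsum (fun k : 'I_K => Eval N B m b g h eta lam sch k j.+1 Gsq (nxt j st om)) <=
    P (nxt j st om).2 - pstar + pot t.+1 * (w + W om).
  move=> wp; have rn := reachS rst wp.
  have jK' : (j.+1 + K <= Sep * m)%N by rewrite addSnnS.
  have W0 : 0 <= W om by exact: nrm2_ge0.
  (* At the end of an epoch the new snapshot is the current point: [w] restarts at 0, and nothing is
     lost because [pot m = 0]. *)
  case E : (j %% m == m.-1)%N.
    have tE : t.+1 = m by rewrite /t (eqP E) prednK.
    have diag : (nxt j st om).1 = (nxt j st om).2 by rewrite /nxt /step E.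
    have := IH j.+1 (nxt j st om) 0 jK' rn (nfin om) (Rle_refl 0).
    rewrite diag nrm2_subxx Rmult_0_r => /(_ (Rle_refl 0)).
    have -> : pot t.+1 = 0 by rewrite /pot tE; ring.
    lra.
  have tE : (j.+1 %% m = t.+1)%N.
    rewrite -addn1 -modnDml addn1 modn_small //.
    have := ltn_pmod j m0; rewrite leq_eqVlt => /orP [/eqP E'|//].
    by move: E; rewrite -[X in _ == X.-1]E' /= eqxx.
  have fixd : (nxt j st om).1 = st.1 by rewrite /nxt /step E.
  have wW : 0 <= w + W om by lra.
  have := IH j.+1 (nxt j st om) (w + W om) jK' rn (nfin om) wW.
  by rewrite tE fixd; apply; exact: nrm2_sub_extend.
rewrite /rsum big_ord_recl -/(rsum _) /=.
have -> : rsum (fun i : 'I_K => Eval N B m b g h eta lam sch (bump 0 i) j Gsq st) =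
    rsum (fun om => wt st om *
      rsum (fun k : 'I_K => Eval N B m b g h eta lam sch k j.+1 Gsq (nxt j st om))).
  rewrite (eq_rsum (F := fun om => wt st om * _) (G := fun om => rsum (fun k : 'I_K =>
    wt st om * Eval N B m b g h eta lam sch k j.+1 Gsq (nxt j st om)))).
    by rewrite rsum_exchange; apply: eq_rsum => k; rewrite /bump leq0n add1n EvalS.
  by move=> om; rewrite rsumZ.
set c := P st.2 - pstar - eta / 2 * Gsq st + pot t.+1 * w.
have step1 : eta / 2 * rsum (fun om => wt st om *
      rsum (fun k : 'I_K => Eval N B m b g h eta lam sch k j.+1 Gsq (nxt j st om))) <=
    c + eta / 2 * (16 * Gamma * (L ^ 2 * nrm2 (vsub st.2 st.1))).
  apply: (Rle_trans _ (rsum (fun om => wt st om * c +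
      eta / 2 * (wt st om * nrm2 (vsub (vdir st om) (gavg g st.2)))))).
    rewrite -rsumZ; apply: ler_rsum => om.
    have := wt_ge0 st om; case/Rle_lt_or_eq_dec => [wp|<-]; last lra.
    (* Outcomes of weight 0 were discharged just before, as both sides vanish. For the others, the
       negative step-length term of [b2'] absorbs the growth [pot t.+1 * W om] of the potential, by
       [b3]. *)
    have b1 := next _ wp; have b2' := step_descent j om Ex.
    have W0 : 0 <= W om by exact: nrm2_ge0.
    have b3 : pot t.+1 * W om <= (1 - rho) / (2 * eta) * W om.
      by apply: Rmult_le_compat_r => //; exact: pot_le.
    rewrite -/(W om) in b2'.
    set y := rsum _ in b1 *; set e := nrm2 _ in b2' *.
    have -> : eta / 2 * (wt st om * y) = wt st om * (eta / 2 * y) by ring.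
    have -> : wt st om * c + eta / 2 * (wt st om * e) = wt st om * (c + eta / 2 * e) by ring.
    by apply: Rmult_le_compat_l; [lra | rewrite /c; lra].
  rewrite rsumD rsumZr wt_sum1 rsumZ.
  have := expected_error jT rst => le.
  by apply: Rplus_le_compat; [lra | apply: Rmult_le_compat_l; lra].
have step2 : eta / 2 * (16 * Gamma * (L ^ 2 * nrm2 (vsub st.2 st.1))) <= a * INR t * w.
  have -> : eta / 2 * (16 * Gamma * (L ^ 2 * nrm2 (vsub st.2 st.1))) = a * nrm2 (vsub st.2 st.1).
    by rewrite /a; field.
  rewrite Rmult_assoc; apply: Rmult_le_compat_l => //; exact: a_ge0.
have step3 : (pot t.+1 + a * INR t) * w <= pot t * w.
  by apply: Rmult_le_compat_r => //; exact: pot_step.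
rewrite Rmult_plus_distr_l; move: step1 step2 step3; rewrite /c; lra.
Qed.

Lemma expected_gmap_bound p0 : (0 < Sep)%N -> Pobj f h x0 = EFin p0 ->
  expected_gmap N B m b g h eta lam sch x0 Sep <=
  2 * L * (p0 - pstar) / (rho * (1 - 2 * rho) * INR (Sep * m)).
Proof.
move=> S0 E0.
have [hx Ex pE] : exists2 r, h x0 = EFin r & p0 = favg f x0 + r.
  move: E0; rewrite /Pobj; case: (h x0) => //= r [<-]; exists r => //; ring.
have TR : 0 < INR (Sep * m) by apply/lt_0_INR/ltP; rewrite muln_gt0 S0.
have p0s : 0 <= p0 - pstar by have := pstarP Ex; lra.
have dist0 : nrm2 (vsub x0 x0) <= INR (0 %% m) * 0 by rewrite nrm2_subxx; lra.
have := @Gsq_sum_bound (Sep * m) 0 (x0, x0) 0 _ _ _ (Rle_refl 0) dist0.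
rewrite add0n leqnn => /(_ isT (reach0 _ _ _ _ _ _ _ _ _ _)) /(_ (ex_intro _ hx Ex)).
rewrite Rmult_0_r Rplus_0_r {1}/P /hval Ex -pE /expected_gmap /Gsq.
set s := rsum _ => le.
have -> : 2 * L * (p0 - pstar) / (rho * (1 - 2 * rho) * INR (Sep * m)) =
    / INR (Sep * m) * (2 / eta * (p0 - pstar) * / (1 - 2 * rho)) by rewrite /eta; field; lra.
apply: Rmult_le_compat_l; first exact/Rlt_le/Rinv_0_lt_compat.
have ie : 0 < 2 / eta by apply: Rdiv_lt_0_compat; lra.
have -> : s = 2 / eta * (eta / 2 * s) by field; lra.
apply: (Rle_trans _ (2 / eta * (p0 - pstar))); first by apply: Rmult_le_compat_l; lra.
(* Since [1 - 2 * rho] lies between 0 and 1, dividing the nonnegative bound by it only enlarges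
   it. *)
rewrite -[X in X <= _]Rmult_1_r; apply: Rmult_le_compat_l; first nra.
by rewrite -Rinv_1; apply: Rinv_le_contravar; lra.
Qed.

End Convergence.

Theorem theorem2
  (d n N Sep m B b : nat)
  (Hn : (0 < n)%N) (HN : (0 < N)%N) (HS : (0 < Sep)%N) (Hm : (0 < m)%N)
  (HB : (0 < B)%N) (Hb : (2 <= b)%N)
  (f : 'I_n -> vec d -> R) (g : 'I_n -> vec d -> vec d)
  (Hg : forall a, has_gradient (f a) (g a))
  (L : R) (HL0 : 0 < L)
  (HL : forall a x y, nrm (vsub (g a x) (g a y)) <= L * nrm (vsub x y))
  (h : vec d -> ereal)
  (Hprop : proper_fun h) (Hconv : convex_fun h) (Hlsc : lsc_fun h)
  (xstar : vec d) (Hmin : forall y, ele (Pobj f h xstar) (Pobj f h y))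
  (rho : R) (Hrho : 0 < rho < 1 / 2)
  (lam : R) (Hlam : 0 < lam <= 1)
  (sch : scheme) (x0 : vec d)
  (dlam : R) (Hdlam0 : 0 <= dlam)
  (Hdlam : forall (j : nat) (st : vec d * vec d), (j < Sep * m)%N ->
     reach N B m b g h (rho / L) lam sch x0 j st ->
     forall (I : {ffun 'I_N -> {ffun 'I_B -> 'I_n}}) (i : 'I_N),
       INR (n_outside b g lam sch st I i) <= dlam)
  (Hcond : match sch with
     | SchC =>
       8 * INR m ^ 2 * rho ^ 2 *
         (3 * INR d * lam ^ 2 / (8 * (2 ^ b.-1 - 1) ^ 2)
          + dlam * (1 - lam) ^ 2 + 1 / (INR N * INR B)) + rho <= 1
     | _ =>
       8 * INR m ^ 2 * rho ^ 2 *
         (INR d * lam ^ 2 / (4 * (2 ^ b.-1 - 1) ^ 2)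
          + dlam * (1 - lam) ^ 2 + 1 / (INR N * INR B)) + rho <= 1
     end) :
  forall p0 pstar : R,
    Pobj f h x0 = EFin p0 -> Pobj f h xstar = EFin pstar ->
    expected_gmap N B m b g h (rho / L) lam sch x0 Sep
      <= 2 * L * (p0 - pstar) / (rho * (1 - 2 * rho) * INR (Sep * m)).
Proof.
move=> p0 pstar E0 Estar.
apply: (expected_gmap_bound Hn HN Hm HB Hb Hg HL0 HL Hprop Hconv Hlsc _ Hrho Hlam Hdlam0
  Hdlam _ HS E0).
  move=> y r hy; have := Hmin y; rewrite Estar /Pobj hy /=; lra.
by clear -Hcond; move: Hcond; rewrite /quant_const; case: sch; lra.
Qed.
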